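(* Let $m_1\ge3$, $m_2\ge3$ and let $G$ be the group of type $\mathcal{D}_4$ $$G=\langle t_1,t_2,x,y\mid t_1^{2^{m_1}}=t_2^{2^{m_2}}=1,\ x^2=t_1,\ y^2=t_2,\ t_1,t_2\text{ central},\ (x,y)=t_1^{2^{m_1-1}}=s\rangle.$$ Let $N=N_1+N_2+N_3+N_4$, where $N_1$ is the number of cyclic subgroups of the centre $\mathcal{Z}(G)$ and $N_2,N_3,N_4$ are, respectively, the numbers of $\mathbb{Q}$-classes of $G$ involving $x$, $y$ and $xy$. Let $N_0$ be the number of cyclic subgroups of $G/G'$. Then $\mathbb{Q}G$ is the direct sum of $N_0$ fields and $N-N_0$ quaternion algebras. Let $M=2N-10$ and $M_0=2N_0-10$. For any finite field $K$ of odd order $q$, the Wedderburn decomposition of the group algebra $KG$ has at least $M$ simple components, a number that is achieved if $q\equiv3\pmod8$, in which case $KG$ is the direct sum of $M_0=2N_0-10$ fields and $M-M_0=2(N-N_0)$ quaternion algebras.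
   Context: $(x,y)$ denotes the group commutator; $G'=\{1,s\}$ is the commutator subgroup and $\mathcal{Z}(G)=\langle t_1\rangle\times\langle t_2\rangle\cong C_{2^{m_1}}\times C_{2^{m_2}}$. The conjugacy classes of $G$ are $\{a\}$ for $a\in\mathcal{Z}(G)$ and $\{w,sw\}$ for $w\notin\mathcal{Z}(G)$. $K$-classes: let $G$ be a finite group of exponent $e$, $K$ a field with characteristic not dividing $|G|$ and $\zeta$ a primitive $e$th root of unity. Each $\sigma\in\mathrm{Gal}(K(\zeta)/K)$ satisfies $\sigma(\zeta)=\zeta^r$ for some $r$, and the maps $g\mapsto g^r$ so obtained act on the set of conjugacy classes of $G$; the orbits are the $K$-classes of $G$. For a noncentral element $z$ of $G$, the $\mathbb{Q}$-classes ''involving $z$'' are those corresponding to (consisting of) conjugacy classes of the form $\{az,saz\}$ with $a\in\mathcal{Z}(G)$. A quaternion algebra means a $4$-dimensional central simple algebra over its centre (a field extension of the ground field); $2\times2$ matrix rings over fields are included. *)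

(* Defs.v *)
From HB Require Import structures.
From mathcomp Require Import all_boot all_order all_algebra.
From mathcomp Require Import all_fingroup all_solvable all_field.

Set Implicit Arguments.
Unset Strict Implicit.
Unset Printing Implicit Defensive.

Import GRing.Theory.
Local Open Scope ring_scope.

(* The group algebra K[gT]: f stands for \sum_g f(g) g.  The codomain is the
   regular module K^o so that the linear structure is that of {ffun _ -> _};
   the multiplication is convolution, not the pointwise product. *)
Definition group_algebra (K : fieldType) (gT : finGroupType) :=
  {ffun gT -> K^o}.

Section GroupAlgebra.

Variables (K : fieldType) (gT : finGroupType).
Local Notation KG := (group_algebra K gT).
Implicit Types f g h : KG.

HB.instance Definition _ := Vector.copy KG {ffun gT -> K^o}.

Definition ga_one : KG := [ffun a => (a == 1%g)%:R].
Definition ga_mul f g : KG := [ffun a => \sum_b f b * g (b^-1 * a)%g].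

Fact ga_mulA : associative ga_mul.
Proof.
move=> f g h; apply/ffunP=> a; rewrite !ffunE.
under eq_bigr do rewrite ffunE mulr_sumr.
under [RHS]eq_bigr do rewrite ffunE mulr_suml.
rewrite [RHS]exchange_big /=; apply: eq_bigr => b _.
rewrite [RHS](reindex_inj (mulgI b)) /=; apply: eq_bigr => c _.
by rewrite mulKg invMg mulgA mulrA.
Qed.

Fact ga_mul1 : left_id ga_one ga_mul.
Proof.
move=> f; apply/ffunP=> a; rewrite ffunE (bigD1 1%g) //= big1 => [|b /negPf nb].
  by rewrite ffunE eqxx mul1r invg1 mul1g addr0.
by rewrite ffunE nb mul0r.
Qed.

Fact ga_mulr1 : right_id ga_one ga_mul.
Proof.
move=> f; apply/ffunP=> a; rewrite ffunE (bigD1 a) //= big1 => [|b nb].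
  by rewrite ffunE mulVg eqxx mulr1 addr0.
by rewrite ffunE -eq_mulVg1 (negPf nb) mulr0.
Qed.

Fact ga_mulDl : left_distributive ga_mul +%R.
Proof.
move=> f g h; apply/ffunP=> a; rewrite !ffunE -big_split /=.
by apply: eq_bigr => b _; rewrite ffunE mulrDl.
Qed.

Fact ga_mulDr : right_distributive ga_mul +%R.
Proof.
move=> f g h; apply/ffunP=> a; rewrite !ffunE -big_split /=.
by apply: eq_bigr => b _; rewrite ffunE mulrDr.
Qed.

Fact ga_one_neq0 : ga_one != 0.
Proof.
by apply/eqP=> /ffunP/(_ 1%g)/eqP; rewrite !ffunE eqxx oner_eq0.
Qed.

HB.instance Definition _ := GRing.Zmodule_isNzRing.Build KG
  ga_mulA ga_mul1 ga_mulr1 ga_mulDl ga_mulDr ga_one_neq0.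

Fact ga_scaleAl (k : K) f g : k *: (f * g) = (k *: f) * g.
Proof.
apply/ffunP=> a; rewrite !ffunE scaler_sumr.
by apply: eq_bigr => b _; rewrite ffunE scalerAl.
Qed.

HB.instance Definition _ := GRing.Lmodule_isLalgebra.Build K KG ga_scaleAl.

Fact ga_scaleAr (k : K) f g : k *: (f * g) = f * (k *: g).
Proof.
apply/ffunP=> a; rewrite !ffunE scaler_sumr.
by apply: eq_bigr => b _; rewrite ffunE scalerAr.
Qed.

HB.instance Definition _ := GRing.Lalgebra_isAlgebra.Build K KG ga_scaleAr.
HB.instance Definition _ := Algebra_isFalgebra.Build K KG.

End GroupAlgebra.

(* Direct sums are internal.  A summand is an {aspace A}, that is, a nonzero
   subspace closed under products which has its own unit algid, in general
   different from 1. *)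
Section Decompositions.

Variables (K : fieldType) (A : falgType K).

Definition two_sided_ideal (U V : {vspace A}) : bool :=
  [&& (V <= U)%VS, (U * V <= V)%VS & (V * U <= V)%VS].

Definition simple_algebra (U : {aspace A}) : Prop :=
  forall V : {vspace A},
    two_sided_ideal U V -> V = 0%VS \/ V = U :> {vspace A}.

Definition field_algebra (U : {aspace A}) : Prop :=
  (forall u v, u \in U -> v \in U -> u * v = v * u) /\
  (forall u, u \in U -> u != 0 -> exists2 v, v \in U & u * v = algid U).

(* The centre of a simple algebra is a field, so the quotient of dimensions
   over K denoted by \dim_ is exact and is the dimension over the centre. *)
Definition quaternion_algebra (U : {aspace A}) : Prop :=
  simple_algebra U /\ \dim_('Z(U)) U = 4.

Definition ideal_direct_sum (I : finType) (B : I -> {aspace A}) : Prop :=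
  [/\ (\sum_i B i)%VS = fullv, directv (\sum_i B i)
    & forall i, two_sided_ideal fullv (B i)].

Definition wedderburn_decomposition (n : nat) (B : 'I_n -> {aspace A}) : Prop :=
  ideal_direct_sum B /\ forall i, simple_algebra (B i).

(* A Wedderburn decomposition exists, and each of them has n components. *)
Definition number_of_simple_components (n : nat) : Prop :=
  forall k : nat,
    (exists B : 'I_k -> {aspace A}, wedderburn_decomposition B) <-> k = n.

Definition sum_of_fields_and_quaternion_algebras (a b : nat) : Prop :=
  exists B : 'I_a + 'I_b -> {aspace A},
    [/\ ideal_direct_sum B, forall i, field_algebra (B (inl i))
      & forall j, quaternion_algebra (B (inr j))].

End Decompositions.

Section KClasses.

Variables (K : fieldType) (L : splittingFieldType K).
Variables (gT : finGroupType) (G : {group gT}).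

(* In this section zeta is meant to be a primitive (exponent G)-th root of 1. *)
Definition galois_exponents (zeta : L) : {set 'I_(exponent G)} :=
  [set r | [exists sigma in 'Gal(<<1; zeta>> / 1)%g,
              (sigma : gal_of _) zeta == zeta ^+ (r : 'I__)]].

Definition K_class (zeta : L) (C : {set gT}) : {set {set gT}} :=
  [set [set (g ^+ r)%g | g in C]
     | r : 'I_(exponent G) in galois_exponents zeta].

Definition K_classes (zeta : L) : {set {set {set gT}}} :=
  [set K_class zeta C | C in classes G].

Definition K_classes_involving (zeta : L) (s z : gT) : {set {set {set gT}}} :=
  [set X in K_classes zeta
     | X \subset [set [set (a * z)%g; (s * a * z)%g] | a in 'Z(G)%g]].

End KClasses.

Definition number_of_cyclic_subgroups (gT : finGroupType) (H : {set gT}) : nat :=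
  #|[set C : {group gT} | (C \subset H) && cyclic C]|.

(* The relations name the generators; the last condition says that all other
   relations follow from these (for a presentation of a finite group, \isog Grp
   is isomorphism with the presented group). *)
Definition presented_D4 (m1 m2 : nat) (gT : finGroupType) (t1 t2 x y : gT) :
    Prop :=
  [/\ <<[set t1; t2; x; y]>>%g = [set: gT],
      [/\ (t1 ^+ (2 ^ m1) = 1)%g, (t2 ^+ (2 ^ m2) = 1)%g,
          (x ^+ 2 = t1)%g & (y ^+ 2 = t2)%g],
      [/\ t1 \in 'Z([set: gT])%g & t2 \in 'Z([set: gT])%g],
      [~ x, y]%g = (t1 ^+ (2 ^ m1.-1))%g
    & ([set: gT] \isog Grp (t1 : t2 : x : y :
        t1 ^+ (2 ^ m1)%N, t2 ^+ (2 ^ m2)%N, x ^+ 2 = t1, y ^+ 2 = t2,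
        [~ t1, t2], [~ t1, x], [~ t1, y], [~ t2, x], [~ t2, y],
        [~ x, y] = t1 ^+ (2 ^ m1.-1)%N))%g].

(* Main.v *)
Require Import Defs.
From HB Require Import structures.
From mathcomp Require Import all_boot all_order all_algebra.
From mathcomp Require Import all_fingroup all_solvable all_field.
From mathcomp Require Import zify.
From Stdlib Require Import Classical.

(* Put e+ = (1 + s)/2 and e- = (1 - s)/2.  Then KG e+ is K[G/G'], and KG e- is
   generated over its centre K[Z(G)] e- by x and y, which anticommute there.  Both
   D+ = KG e+ and D- = K[Z(G)] e- are direct sums of fields D e, with e a
   primitive idempotent, and KG e is quaternion over D- e for e in D-.  The
   number of summands of D is the dimension of the span V of its idempotents.
   Over the rationals, V consists of the elements whose coefficients are invariant
   under g |-> g^r for r odd; over a field with q elements, where u^q is obtained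
   from u by g |-> g^q, of those invariant under g |-> g^q (Berlekamp).

   Hence dim V+ counts orbits of power maps on G/G', that is, cyclic subgroups in
   the rational case, and dim V- is a difference of two such counts, for Z(G) and
   for Z(G)/<s>.  For odd q, a cyclic subgroup of order at least 8 splits into at
   least two q-orbits, since the powers of q do not fill the odd residues modulo
   8, while each of the 10 cyclic subgroups of order at most 4 may give a single
   orbit.  In D-, a root t of t^4 = s yields square roots of -1, 2 and -2, one of
   which is fixed by the q-power map but not by all odd power maps, so that dim V-
   at least doubles.  When q = 3 modulo 8, q and -1 generate all odd residues, and
   both bounds are attained. *)

Set Implicit Arguments.
Unset Strict Implicit.
Unset Printing Implicit Defensive.

Import GRing.Theory.

(** * Powers modulo 2^k and cyclic subgroups of 2-groups *)

(** One construction serves both halves: D is the space of elements supported on H on which s acts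
    as the scalar l, with (H, l) = (G, 1) or (Z(G), -1). For a primitive idempotent e of V two facts
    are needed: V e = K e, so that these idempotents form a basis of V, and D e is a field. Over a
    finite field both follow from the Frobenius map. Over the rationals, V is spanned by sums over
    cyclic groups, and D e is generated by a root of unity with the irreducible equation X - 1 = 0
    or X^(2^j) + 1 = 0.

    N enters because a Q-class of noncentral elements amounts to a cyclic subgroup of G/G' not
    contained in Z(G)/<s>. So N0 is N2 + N3 + N4 plus the count for Z(G)/<s>, and N - N0 is the
    difference of the counts for Z(G) and Z(G)/<s>.

    Over a finite field dim V- is also a difference of orbit counts, but lower bounds cannot be
    subtracted; this is why square roots replace counting there. Finally, the defining relations
    hold in smaller groups too: that s is nontrivial and that G/G' is as large as expected must be
    seen on explicit quotients of G. *)

Lemma pow_mod8 q i : odd q -> q ^ i = 1 %[mod 8] \/ q ^ i = q %[mod 8].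
Proof.
move=> oddq; have q2 : q * q = 1 %[mod 8].
  have : odd (q %% 8) by rewrite odd_mod.
  rewrite -modnMm; have : q %% 8 < 8 by rewrite ltn_mod.
  by case: (q %% 8) => [|[|[|[|[|[|[|[|]]]]]]]].
elim: i => [|i [IHi|IHi]]; first by left.
  by right; rewrite expnS -modnMmr IHi modnMmr muln1.
by left; rewrite expnS -modnMmr IHi modnMmr.
Qed.

(* q^2^(j+1) = 1 + 2^(j+3) (mod 2^(j+4)), so adjusting the exponent by 2^(j+1)
   lifts a solution from modulus 2^(j+3) to 2^(j+4). *)
Lemma pow3_pow2 q j : q = 3 %[mod 8] ->
  exists2 o, odd o & q ^ (2 ^ j.+1) = 1 + 2 ^ j.+3 * o.
Proof.
move=> q3; elim: j => [|j [o oddo IHj]].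
  have := divn_eq q 8; rewrite q3 (_ : 3 %% 8 = 3)//; set a := q %/ 8 => ->.
  exists (8 * a * a + 6 * a + 1); first by rewrite addn1 /= oddD !oddM.
  rewrite (_ : 2 ^ 1 = 2)// (_ : 2 ^ 3 = 8)// expnS expn1; nia.
exists (o + 2 ^ j.+2 * o * o).
  by rewrite oddD oddo expnS -!mulnA oddM.
have -> : q ^ (2 ^ j.+2) = q ^ (2 ^ j.+1) * q ^ (2 ^ j.+1).
  by rewrite -expnD addnn -mul2n -expnS.
rewrite IHj [2 ^ j.+4]expnS [2 ^ j.+3]expnS; nia.
Qed.

Lemma modn_double_parity x B rho : rho < B ->
  (x * B + rho) %% (2 * B) = odd x * B + rho.
Proof.
move=> ltB; have -> : x * B + rho = x./2 * (2 * B) + (odd x * B + rho).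
  by rewrite -{1}(odd_double_half x); lia.
rewrite modnMDl modn_small//; case: (odd x); lia.
Qed.

Lemma pow3_cover13 q k r : q = 3 %[mod 8] -> r = 1 %[mod 8] \/ r = 3 %[mod 8] ->
  exists i, q ^ i = r %[mod 2 ^ k.+3].
Proof.
move=> q3 r13; elim: k => [|k [i qi]].
  by case: r13 => ->; [exists 0 | exists 1].
have [o oddo qo] := pow3_pow2 k q3.
have [qr|nqr] := eqVneq (q ^ i %% 2 ^ k.+4) (r %% 2 ^ k.+4); first by exists i.
have oddq : odd (q ^ i) by rewrite oddX -(@odd_mod q 8)// q3 orbT.
(* Multiplying by q^(2^(k+1)) = 1 + B o adds an odd multiple of B, which flips the parity of the
   quotient by B; the two residues modulo 2B differ in exactly that parity. *)
exists (i + 2 ^ k.+1); rewrite expnD qo; move: nqr.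
set A := q ^ i in qi oddq *; set B := 2 ^ k.+3 in qi *.
have -> : 2 ^ k.+4 = 2 * B by rewrite expnS.
have B_gt0 : 0 < B by rewrite expn_gt0.
have evB : odd B = false by rewrite oddX.
have ltB z : z %% B < B by rewrite ltn_mod.
have AE := divn_eq A B; have rE := divn_eq r B.
have -> : A * (1 + B * o) = (A %/ B + A * o) * B + A %% B.
  by rewrite mulnDr muln1 {1}AE; lia.
rewrite {1}AE {1 2}rE !modn_double_parity// qi oddD oddM oddq oddo addbT.
by case: (odd (A %/ B)); case: (odd (r %/ B)); rewrite ?eqxx.
Qed.

(** Powers of q reach the residues that are 1 or 3 modulo 8, and their opposites reach those that
    are 5 or 7. The second alternative means q^i = -r. The modulus is enlarged to 2^(k+3) so that
    residues modulo 8 make sense. *)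
Lemma pow3_cover q k r : q = 3 %[mod 8] -> odd r ->
  exists i, q ^ i = r %[mod 2 ^ k] \/ 2 ^ k %| q ^ i + r.
Proof.
move=> q3 oddr; suff [i] : exists i, q ^ i = r %[mod 2 ^ k.+3] \/ 2 ^ k.+3 %| q
  ^ i + r.
  have dv : 2 ^ k %| 2 ^ k.+3 by rewrite dvdn_exp2l// !leqW.
  move=> [qr|dr]; exists i; [left | right; exact: dvdn_trans dv dr].
  by rewrite -(modn_dvdm (q ^ i) dv) qr modn_dvdm.
have : odd (r %% 8) by rewrite odd_mod.
have : r %% 8 < 8 by rewrite ltn_mod.
have small r' : r' %% 8 = 1 \/ r' %% 8 = 3 ->
  exists i, q ^ i = r' %[mod 2 ^ k.+3].
  by move=> r13; apply: pow3_cover13.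
have neg : r %% 8 = 5 \/ r %% 8 = 7 -> exists i, 2 ^ k.+3 %| q ^ i + r.
  (* [m] is a natural number congruent to -r, hence to 3 or 1 modulo 8. *)
  move=> r57; have := divn_eq r 8; set m := 2 ^ k.+3 * r - r.
  have p8 : 2 ^ k.+3 = 8 * 2 ^ k by rewrite !expnS; lia.
  have k_gt0 : 0 < 2 ^ k by rewrite expn_gt0.
  have rm : m + r = 2 ^ k.+3 * r by rewrite subnK// leq_pmull// expn_gt0.
  move=> rE; have [|i qi] := small m.
    have : (m + r) %% 8 = 0 by rewrite rm p8 -mulnA modnMr.
    by clearbody m; clear -r57; lia.
  exists i; rewrite /dvdn -modnDml qi modnDml rm modnMr.
  exact: eqxx.
case E : (r %% 8) => [|[|[|[|[|[|[|[|]]]]]]]] //= _ _.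
- by have [|i qi] := small r; [left | exists i; left].
- by have [|i qi] := small r; [right | exists i; left].
- by have [|i qi] := neg; [left | exists i; right].
- by have [|i qi] := neg; [right | exists i; right].
Qed.

Lemma number_of_cyclic_subgroupsE (gT : finGroupType) (H : {group gT}) :
  number_of_cyclic_subgroups H = #|(fun a : gT => <[a]>%g) @: H|.
Proof.
rewrite /number_of_cyclic_subgroups -(card_imset _ val_inj);
  congr #|pred_of_set _|.
apply/setP=> C; apply/imsetP/imsetP => [[D + ->]|[a Ha ->]].
  rewrite inE => /andP[sDH /cyclicP[a Da]]; exists a => //.
  by rewrite (subsetP sDH)// Da cycle_id.
by exists <[a]>%G; rewrite // inE cycle_subG Ha cycle_cyclic.
Qed.

Lemma cycle_eq_oddP (gT : finGroupType) (c d : gT) : (2.-elt c)%g ->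
  <[c]>%g = <[d]>%g <-> exists2 r, odd r & d = (c ^+ r)%g.
Proof.
move=> pc; have [k ok] := p_natP pc; split=> [cd|[r oddr ->]]; last first.
  have : generator <[c]> (c ^+ r)%g by rewrite generator_coprime ok coprimeXl//
    coprime2n.
  by move/eqP.
have := cycle_id d; rewrite -cd => /cycleP[r dE].
have : generator <[c]> (c ^+ r)%g by rewrite -dE; apply/eqP.
rewrite generator_coprime ok; case: k ok => [|k] ok co.
  by move: dE; rewrite (eqP (_ : c == 1%g)) -?order_eq1 ?ok// expg1n;
    exists 1%N; rewrite ?expg1.
by exists r => //; move: co; rewrite coprime_pexpl// coprime2n.
Qed.

Definition power_orbit (gT : finGroupType) (q : nat) (c : gT) : {set gT} :=
  [set d | fconnect (fun a : gT => a ^+ q)%g c d].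

Section SmallCycles.

Variable gT : finGroupType.
Local Notation cycles := ((fun c : gT => <[c]>%g) @: [set: gT]).
Hypothesis G2 : (2.-group [set: gT])%g.

Let pelt (c : gT) : (2.-elt c)%g.
Proof. by apply: (mem_p_elt G2); rewrite inE. Qed.

Let card_order (d : nat) : #|[set a : gT | #[a]%g == d]| = #|[set C in cycles |
  #|C| == d]| * totient d.
Proof.
rewrite -sum1_card (partition_big (fun a => <[a]>%g) (mem [set C in cycles |
  #|C| == d])) /=.
  rewrite -sum_nat_const; apply: eq_bigr => C;
    rewrite inE => /andP[/imsetP[c _ ->] /eqP oc].
  rewrite -oc totient_gen -sum1_card; apply: eq_bigl => a; rewrite !inE.
  rewrite /generator [RHS]eq_sym; apply: andb_idl => /eqP ac.
  by rewrite orderE -ac.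
by move=> a; rewrite !inE -orderE => ->; rewrite imset_f ?inE.
Qed.

(** The 4 elements of order at most 2 generate 4 distinct subgroups; the remaining 16 - 4 = 12
    elements have order 4 and generate 6 subgroups, two generators each. *)
Lemma card_small_cycles :
    #|'Ldiv_2([set: gT])%g| = 4 -> #|'Ldiv_4([set: gT])%g| = 16 ->
  #|[set C in cycles | #|C| <= 4]| = 10.
Proof.
move=> L2 L4; pose cyc (d : nat) := #|[set C in cycles | #|C| == d]|.
have cardE (T : finType) (A : {set T}) : #|A| = \sum_(z : T) (z \in A).
  by rewrite -sum1_card big_mkcond.
have o1 : #|[set a : gT | #[a]%g == 1]| = cyc 1 by rewrite card_order muln1.
have o2 : #|[set a : gT | #[a]%g == 2]| = cyc 2 by rewrite card_order muln1.
have o4 : #|[set a : gT | #[a]%g == 4]| = 2 * cyc 4 by rewrite card_order mulnC.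
have eq4 : cyc 1 + cyc 2 + 2 * cyc 4 = 16.
  rewrite -L4 -o1 -o2 -o4.
  rewrite !cardE -!big_split; apply: eq_bigr => a _;
    rewrite !inE /= -order_dvdn.
  by have := order_gt0 a; case: (#[a]%g) => [|[|[|[|[|m]]]]].
have eq2 : cyc 1 + cyc 2 = 4.
  rewrite -L2 -o1 -o2.
  rewrite !cardE -!big_split; apply: eq_bigr => a _;
    rewrite !inE /= -order_dvdn.
  by have := order_gt0 a; case: (#[a]%g) => [|[|[|m]]].
suff -> : #|[set C in cycles | #|C| <= 4]| = cyc 1 + cyc 2 + cyc 4 by lia.
rewrite /cyc !cardE -!big_split; apply: eq_bigr => C _; rewrite !inE /=.
case: (boolP (C \in _)) => //= /imsetP[c _ ->].
have [k] := p_natP (pelt c); rewrite orderE => ->.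
case: k => [|[|[|k]]] //.
have k_gt0 : 0 < 2 ^ k by rewrite expn_gt0.
by rewrite !expnS; case: leqP; do 3 case: eqVneq; lia.
Qed.

End SmallCycles.

(** * Orbits of the q-power map on a 2-group, counted by the cyclic subgroups they generate *)

Section PowerOrbits.

Variables (gT : finGroupType) (q : nat).
Implicit Types (c d : gT).
Local Notation orb := (@power_orbit gT q).
Local Notation cycles := ((fun c : gT => <[c]>%g) @: [set: gT]).

Hypothesis G2 : (2.-group [set: gT])%g.
Hypothesis oddq : odd q.

Let pelt c : (2.-elt c)%g.
Proof. by apply: (mem_p_elt G2); rewrite inE. Qed.

Let expq_inj : injective (fun a : gT => a ^+ q)%g.
Proof.
have co : coprime #|[set: gT]| q.
  by have [k ->] := p_natP G2; rewrite coprimeXl// coprime2n.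
by move=> a b /= eqab; rewrite -[a](@expgK _ [set: gT]%G q) ?inE// eqab expgK
  ?inE.
Qed.

Let iter_expq i c : iter i (fun a : gT => a ^+ q)%g c = (c ^+ (q ^ i))%g.
Proof. by elim: i => [|i IHi]; rewrite ?expg1// iterS IHi -expgM -expnSr. Qed.

Lemma power_orbitP c d : orb c = orb d <-> exists i, d = (c ^+ (q ^ i))%g.
Proof.
split=> [/setP/(_ d)|[i ->]].
  rewrite !inE connect0 => /iter_findex <-;
    exists (findex (fun a : gT => a ^+ q)%g c d).
  by rewrite iter_expq.
apply/setP=> b; rewrite !inE; apply: same_connect;
  first exact: fconnect_sym expq_inj.
by rewrite -iter_expq fconnect_iter.
Qed.

Lemma gen_power_orbit c : <<orb c>>%g = <[c]>%g.
Proof.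
apply/eqP; rewrite eqEsubset gen_subG cycle_subG mem_gen ?inE ?connect0// andbT.
apply/subsetP=> d; rewrite inE => /iter_findex <-.
by rewrite iter_expq mem_cycle.
Qed.

Lemma odd_power_cycle c r : odd r -> <[c ^+ r]>%g = <[c]>%g.
Proof. by move=> oddr; apply/esym/cycle_eq_oddP; [apply: pelt | exists r]. Qed.

Let fiber (C : {set gT}) := [set o in orb @: [set: gT] | <<o>>%g == C].

Lemma card_power_orbits : #|orb @: [set: gT]| = \sum_(C in cycles) #|fiber C|.
Proof.
rewrite -sum1_card (partition_big (fun o => <<o>>%g) (mem cycles)) /=.
  by apply: eq_bigr => C _; rewrite -sum1_card; apply: eq_bigl => o;
    rewrite inE.
by move=> _ /imsetP[c _ ->]; rewrite gen_power_orbit imset_f.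
Qed.

Lemma fiber_lower c : (if #[c]%g <= 4 then 1 else 2) <= #|fiber <[c]>%g|.
Proof.
have fc d : <[d]>%g = <[c]>%g -> orb d \in fiber <[c]>%g.
  by move=> dc; rewrite inE imset_f ?inE// gen_power_orbit dc eqxx.
case: ifPn => [_|].
  by apply/card_gt0P; exists (orb c); apply: fc.
(* Powers of q are 1 or q modulo 8, so 3 is not among them unless q = 3 modulo 8, in which case 5 is
   not. *)
rewrite -ltnNge => c_gt4; pose r := if q %% 8 == 3 then 5 else 3.
have oddr : odd r by rewrite /r; case: ifP.
have /subset_leq_card : [set orb c; orb (c ^+ r)%g] \subset fiber <[c]>%g.
  by rewrite subUset !sub1set !fc// odd_power_cycle.
rewrite cards2; suff -> : orb c != orb (c ^+ r)%g by [].
apply/eqP => /power_orbitP[i /eqP]; rewrite eq_expg_mod_order => /eqP cr.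
have d8 : 8 %| #[c]%g.
  have [k ok] := p_natP (pelt c); rewrite ok in c_gt4 *.
  by apply: (@dvdn_exp2l 2 3); rewrite ltnNge -(leq_exp2l (m := 2)) // -ltnNge.
have : r = q ^ i %[mod 8] by rewrite -(modn_dvdm r d8) cr modn_dvdm.
have := pow_mod8 i oddq; rewrite /r; case: ifP => [/eqP q3|q3].
  by case=> ->; rewrite ?q3.
by case=> -> // /esym/eqP; rewrite q3.
Qed.

(** Every odd exponent is plus or minus a power of q, so each generator lies in the orbit of c or of
    its inverse. These orbits coincide when the order divides 4, because q = -1 modulo 4. *)
Lemma fiber_upper c : q = 3 %[mod 8] ->
  #|fiber <[c]>%g| <= (if #[c]%g <= 4 then 1 else 2).
Proof.
move=> q3; have sub : fiber <[c]>%g \subset [set orb c; orb c^-1%g].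
  apply/subsetP=> o; rewrite inE => /andP[/imsetP[d _ ->{o}]].
  rewrite gen_power_orbit eq_sym => /eqP /(cycle_eq_oddP _ (pelt c))[r oddr ->].
  have [k ok] := p_natP (pelt c).
  have [i [qi|qi]] := pow3_cover k q3 oddr; rewrite !inE.
    apply/orP; left; rewrite eq_sym; apply/eqP/power_orbitP; exists i.
    by apply/eqP; rewrite eq_expg_mod_order ok qi.
  apply/orP; right; rewrite eq_sym; apply/eqP/power_orbitP; exists i.
  rewrite expVgn; apply/eqP; rewrite eq_sym eq_invg_mul -expgD -order_dvdn ok.
  by [].
apply: leq_trans (subset_leq_card sub) _; rewrite cards2.
case: ifPn => [c4|_]; last by case: (_ != _).
suff -> : orb c = orb c^-1%g by rewrite eqxx.
apply/power_orbitP; exists 1%N; rewrite expn1.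
apply/eqP; rewrite eq_invg_mul -expgS -order_dvdn.
have q4 : 4 %| q.+1 by lia.
apply: dvdn_trans q4; have [k ok] := p_natP (pelt c); rewrite ok in c4 *.
by apply: (@dvdn_exp2l 2 k 2); rewrite -(leq_exp2l (m := 2)).
Qed.

Let small := [set C in cycles | #|C| <= 4].

Let sum_small : \sum_(C in cycles) (if #|C| <= 4 then 1 else 2) + #|small| = 2 *
  #|cycles|.
Proof.
have -> : #|small| = \sum_(C in cycles) (#|C| <= 4).
  rewrite -sum1_card big_mkcond [RHS]big_mkcond; apply: eq_bigr => C _.
  by rewrite inE; case: (_ \in _) => //=; case: (_ <= _).
rewrite -big_split mulnC -sum_nat_const; apply: eq_bigr => C _.
by case: (_ <= _).
Qed.

Lemma card_power_orbits_ge : 2 * #|cycles| - #|[set C in cycles | #|C| <= 4]| <=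
  #|orb @: [set: gT]|.
Proof.
rewrite card_power_orbits -sum_small addnK; apply: leq_sum => _ /imsetP[c _ ->].
exact: fiber_lower.
Qed.

Lemma card_power_orbits_eq : q = 3 %[mod 8] ->
  #|orb @: [set: gT]| = 2 * #|cycles| - #|[set C in cycles | #|C| <= 4]|.
Proof.
move=> q3; rewrite card_power_orbits -sum_small addnK;
  apply: eq_bigr => _ /imsetP[c _ ->].
by apply/eqP; rewrite eqn_leq fiber_upper//= fiber_lower.
Qed.

End PowerOrbits.

(** * The group of type D4 *)

Section GroupD4.

Local Open Scope group_scope.

Variables (m1 m2 : nat) (gT : finGroupType) (t1 t2 x y : gT).
Hypothesis m1_ge3 : 3 <= m1.
Hypothesis D4 : presented_D4 m1 m2 t1 t2 x y.
Local Notation G := [set: gT]%G.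
Local Notation s := (t1 ^+ (2 ^ m1.-1)).

(** The only use of the isomorphism with the presented group: any group with such generators is a
    quotient of G, with t1 and t2 sent to the squares of X and Y. Lower bounds on G come from
    here. *)
Lemma D4_homg (rT : finGroupType) (X Y : rT) :
    <<[set X; Y]>> = [set: rT] -> X ^+ (2 ^ m1.+1) = 1 ->
      Y ^+ (2 ^ m2.+1) = 1 ->
    X ^+ 2 \in 'Z([set: rT]) -> Y ^+ 2 \in 'Z([set: rT]) ->
    [~ X, Y] = X ^+ (2 ^ m1) ->
  [set: rT] \homg [set: gT].
Proof.
case: D4 => _ _ _ _ -> gen oX oY /centerP[_ cX] /centerP[_ cY] cXY.
have com_1 (a b : rT) : commute a b -> [~ a, b] = 1 by move=> cab;
  apply/eqP/commgP.
apply/existsP; exists (X ^+ 2, Y ^+ 2, X, Y); rewrite /= !xpair_eqE.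
rewrite -!expgM -!expnS oX oY !eqxx cXY.
rewrite prednK ?(leq_trans _ m1_ge3)// !eqxx /=.
rewrite !(com_1 (X ^+ 2)) ?(com_1 (Y ^+ 2)) ?eqxx; try by [apply: cX;
  rewrite inE | apply: cY; rewrite inE].
rewrite !andbT eqEsubset subsetT /= -gen gen_subG subUset !sub1set.
rewrite -!cycle_subG joing_subr andbT.
exact: subset_trans (joing_subr _ _) (joing_subl _ _).
Qed.

(** The quotient is the modular group of order 2^(m1+2), with X of order 2^(m1+1), Y of order 2 and
    X^Y = X^(1+2^m1); t2 becomes trivial there. *)
Lemma D4_nonabelian : ~~ abelian [set: gT].
Proof.
have n_gt2 : 2 < m1.+2 by rewrite !ltnS (leq_trans _ m1_ge3).
have [[X Y] genM modM] := generators_modular_group (isT : prime 2) n_gt2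
  (isog_refl _).
have [_ _ ordX _] := genM.
have [[defM nabM _] [defZ _ _] _ _ _] :=
  modular_group_structure (isT : prime 2) n_gt2 genM (isog_refl _) modM.
have [oY XY] := modM.
apply: contra nabM; suff /homgP[f fE] : [set: 'Mod_(2 ^ m1.+2)] \homg [set: gT].
  by move=> abG; have := morphim_abelian f abG; rewrite fE.
have X2 : X ^+ 2 \in 'Z([set: 'Mod_(2 ^ m1.+2)]) by rewrite defZ cycle_id.
apply: (@D4_homg _ X Y) => //.
- by rewrite -(sdprodWY defM) joing_idl joing_idr.
- by apply/eqP; rewrite -order_dvdn ordX.
- by apply/eqP; rewrite -order_dvdn oY expnS dvdn_mulr.
- by have := expg_order Y; rewrite oY => ->; rewrite group1.
- by rewrite /commg -/(X ^ Y) XY expgS mulKg.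
Qed.

Lemma D4_t1E : t1 = x ^+ 2. Proof. by case: D4 => _ []. Qed.
Lemma D4_t2E : t2 = y ^+ 2. Proof. by case: D4 => _ []. Qed.

Lemma D4_sE : s = x ^+ (2 ^ m1).
Proof. by rewrite D4_t1E -expgM -expnS prednK// (leq_trans _ m1_ge3). Qed.

Lemma D4_gen : <<[set x; y]>> = [set: gT].
Proof.
apply/eqP; rewrite eqEsubset subsetT /=; case: D4 => <- _ _ _ _.
have xG : x \in <<[set x; y]>> by rewrite mem_gen ?inE ?eqxx.
have yG : y \in <<[set x; y]>> by rewrite mem_gen ?inE ?eqxx ?orbT.
rewrite gen_subG !subUset !sub1set xG yG !andbT.
by rewrite D4_t1E D4_t2E !groupX.
Qed.

Lemma D4_t1Z : t1 \in 'Z(G). Proof. by case: D4 => _ _ []. Qed.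

Lemma D4_sZ : s \in 'Z(G). Proof. exact: groupX D4_t1Z. Qed.

Lemma D4_sC g : commute s g.
Proof. by have /centerP[_] := D4_sZ; apply; rewrite inE. Qed.

Lemma D4_ss : s * s = 1.
Proof.
case: D4 => _ [t1n _ _ _] _ _ _; rewrite -expgD addnn -mul2n -expnS prednK//.
exact: leq_trans m1_ge3.
Qed.

Lemma D4_comm : [~ x, y] = s. Proof. by case: D4. Qed.

Lemma D4_s_neq1 : s != 1.
Proof.
apply: contra D4_nonabelian => /eqP s1.
rewrite -D4_gen abelian_gen; have /commgP cxy : [~ x,
  y] == 1 by rewrite D4_comm s1.
apply/centsP => a + b; rewrite !inE => /orP[]/eqP-> /orP[]/eqP-> //.
Qed.

Lemma D4_der_sub : G^`(1) \subset <[s]>.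
Proof.
have nsG : G \subset 'N(<[s]>).
  by rewrite cents_norm// centsC cycle_subG; have /setIP[] := D4_sZ.
apply: der1_min => //; have sSN : [set x; y] \subset 'N(<[s]>).
  exact: subset_trans (subsetT _) nsG.
rewrite -[X in X / _]/[set: gT] -D4_gen quotient_gen// abelian_gen;
  apply/centsP.
move=> _ /morphimP[a Na aS ->] _ /morphimP[b Nb bS ->].
apply/commgP; rewrite -morphR//= coset_id//.
have ss : s \in <[s]> := cycle_id s.
move: aS bS; rewrite !inE => /orP[]/eqP-> /orP[]/eqP->;
  rewrite ?commgg ?group1// ?D4_comm//.
by rewrite -invg_comm D4_comm groupV.
Qed.

Lemma D4_commutator g h : [~ g, h] = 1 \/ [~ g, h] = s.
Proof.
have : [~ g, h] \in <[s]>.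
  by apply: (subsetP D4_der_sub); rewrite mem_commg ?inE.
case/cycleP => k ->; rewrite -[k]odd_double_half expgD -mul2n expgM.
rewrite [s ^+ 2]D4_ss expg1n mulg1.
by case: (odd k); [right | left].
Qed.

Lemma D4_centerP g :
  reflect (commute g x /\ commute g y) (g \in 'Z(G)).
Proof.
apply: (iffP idP) => [/centerP[_ cg]|[cx cy]].
  by split; apply: cg; rewrite inE.
apply/centerP; split; rewrite ?inE// => h _; apply/commute_sym/cent1P.
suff /subsetP : G \subset 'C[g] by apply; rewrite inE.
by rewrite -[gval G]/[set: gT] -D4_gen gen_subG subUset !sub1set; apply/andP;
  split; apply/cent1P.
Qed.

Lemma D4_derE : G^`(1) = <[s]>.
Proof.
apply/eqP; rewrite eqEsubset D4_der_sub cycle_subG.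
by have := mem_commg (in_setT x) (in_setT y); rewrite D4_comm.
Qed.

Lemma D4_conj_s a : a \notin 'Z(G) -> exists h, a ^ h = s * a.
Proof.
move=> nZa; have [h nch] : exists h, [~ a, h] <> 1.
  have [cx|ncx] := eqVneq [~ a, x] 1; last by exists x; apply/eqP.
  have [cy|ncy] := eqVneq [~ a, y] 1; last by exists y; apply/eqP.
  by case/D4_centerP: nZa; split; apply/commgP/eqP.
exists h; have [//|ch] := D4_commutator a h.
by rewrite [RHS]D4_sC -ch commgEl mulKVg.
Qed.

(** The pair ([x,a], [y,a]) determines the coset of a modulo the centre. At 1, x, y, xy it is (1,1),
    (1,s), (s,1), (s,s), which are all the possible values, so these elements represent the
    cosets. *)
Lemma D4_mem_coset a b :
  (a * b^-1 \in 'Z(G)) = ([~ x, a] == [~ x, b]) && ([~ y, a] == [~ y, b]).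
Proof.
have comE c : ([~ c, a] == [~ c, b]) = (c ^ (a * b^-1) == c).
  by rewrite !commgEl (inj_eq (mulgI _)) conjgM -[RHS](inj_eq (@conjg_inj _ b))
    conjgKV.
have fixE (c g : gT) : (c ^ g == c) = ([~ g, c] == 1).
  by rewrite -(inj_eq (mulgI c^-1)) mulVg -commgEl -invg_comm eq_invg1.
rewrite !comE !fixE; apply/D4_centerP/andP => -[cx cy].
  by split; apply/commgP.
by split; apply/commgP.
Qed.

Definition D4_rep (i : 'I_4) : gT := tnth [tuple 1; x; y; x * y] i.

Let s_neq1 : (s == 1) = false. Proof. exact: negbTE D4_s_neq1. Qed.
Let yx : [~ y, x] = s.
Proof. by rewrite -invg_comm D4_comm; apply/eqP; rewrite eq_invg_mul D4_ss. Qed.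
Let x_xy : [~ x, x * y] = s.
Proof. by rewrite commgMJ commgg conj1g mulg1 D4_comm. Qed.
Let y_xy : [~ y, x * y] = s.
Proof. by rewrite commgMJ commgg mul1g yx conjgE D4_sC mulKg. Qed.

Lemma D4_rep_cover a : exists i, a * (D4_rep i)^-1 \in 'Z(G).
Proof.
have [xa|xa] := D4_commutator x a; have [ya|ya] := D4_commutator y a.
- by exists (Ordinal (isT : 0 < 4)); rewrite D4_mem_coset xa ya /= !commg1 eqxx.
- by exists (Ordinal (isT : 1 < 4)); rewrite D4_mem_coset xa ya /= commgg yx
  !eqxx.
- by exists (Ordinal (isT : 2 < 4)); rewrite D4_mem_coset xa ya /= commgg
  D4_comm !eqxx.
- by exists (Ordinal (isT : 3 < 4)); rewrite D4_mem_coset xa ya /= x_xy y_xy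
  !eqxx.
Qed.

Lemma D4_rep_inj a i j :
  a * (D4_rep i)^-1 \in 'Z(G) -> a * (D4_rep j)^-1 \in 'Z(G) -> i = j.
Proof.
rewrite !D4_mem_coset => /andP[/eqP-> /eqP->].
case: i => -[|[|[|[|//]]]] i; case: j => -[|[|[|[|//]]]] j; move=> /=;
  rewrite /D4_rep /tnth /= ?commg1 ?commgg ?yx ?x_xy ?y_xy ?D4_comm ?eqxx
    ?[1 == _]eq_sym ?s_neq1 //= => _; exact: val_inj.
Qed.

End GroupD4.

(** * The abelianization of G as a product of two cyclic groups *)

Section AbelianizationD4.

Local Open Scope group_scope.

Variables (m1 m2 : nat) (gT : finGroupType) (t1 t2 x y : gT).
Hypotheses (m1_ge3 : 3 <= m1) (m2_ge3 : 3 <= m2).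
Hypothesis D4 : presented_D4 m1 m2 t1 t2 x y.
Local Notation G := [set: gT]%G.
Local Notation s := (t1 ^+ (2 ^ m1.-1)).
Local Notation Q := (G / G^`(1)).
Local Notation X := (coset G^`(1) x).
Local Notation Y := (coset G^`(1) y).

Let nsG : G^`(1) <| G := der_normal 1 G.
Let inN g : g \in 'N(G^`(1)).
Proof. by apply: (subsetP (normal_norm nsG)); rewrite inE. Qed.

Lemma D4_oX : X ^+ (2 ^ m1) = 1.
Proof.
rewrite -morphX//= -(D4_sE m1_ge3 D4) coset_id// (D4_derE D4).
exact: cycle_id.
Qed.

Lemma D4_oY : Y ^+ (2 ^ m2.+1) = 1.
Proof.
rewrite -morphX//= expnS expgM -(D4_t2E D4); case: D4 => _ [_ -> _ _] _ _ _.
exact: morph1.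
Qed.

Lemma D4_quotient : <[X]> * <[Y]> = Q.
Proof.
have sSN : [set x; y] \subset 'N(G^`(1)).
  by apply/subsetP=> z _; apply: inN.
have genQ : <[X]> <*> <[Y]> = Q.
  have -> : Q = <<[set x; y]>> / G^`(1) by rewrite (D4_gen D4).
  rewrite quotient_gen// quotientU.
  by rewrite !quotient_set1 // joing_idl joing_idr.
rewrite -genQ cent_joinEl// (sub_abelian_cent2 (der_abelian 0 G))//.
  by rewrite cycle_subG mem_quotient ?inE.
by rewrite cycle_subG mem_quotient ?inE.
Qed.

Lemma D4_pgroup : 2.-group [set: gT].
Proof.
have p2 : prime 2 by [].
have pQ : 2.-group Q.
  rewrite -D4_quotient pgroupM.
  by rewrite /pgroup -!orderE (pnat_dvd (m := #[X]) (n := 2 ^ m1)) ?(pnat_dvd (m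
    := #[Y]) (n := 2 ^ m2.+1))
    ?pnatX ?pnat_id ?orbT ?order_dvdn ?D4_oX ?D4_oY.
have pS : 2.-group G^`(1).
  rewrite (D4_derE D4) /pgroup -orderE (pnat_dvd (n := 2)) ?pnat_id//.
  by rewrite order_dvdn; apply/eqP; apply: (D4_ss m1_ge3 D4).
have : 2.-nat (#|G^`(1)| * #|Q|)%N by rewrite pnatM; apply/andP.
by rewrite card_quotient ?normal_norm// Lagrange ?subsetT.
Qed.

Lemma D4_card_gt1 : 1 < #|[set: gT]|.
Proof.
rewrite cardG_gt1; apply: contra (D4_s_neq1 m1_ge3 D4) => /eqP G1.
by have := in_setT s; rewrite G1 => /set1P->.
Qed.

(** The product of cyclic groups of orders 2^m1 and 2^(m2+1) is an abelian quotient of G, hence of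
    G/G': the relation on the commutator holds there because the image of x has order dividing
    2^m1. *)
Lemma D4_card_quotient : 2 ^ m1 * 2 ^ m2.+1 <= #|Q|.
Proof.
pose A := ('Z_(2 ^ m1) * 'Z_(2 ^ m2.+1))%type.
have /homgP[f fE] : [set: A] \homg [set: gT].
  have expZ n (z : 'Z_(2 ^ n)) k : (0 < n)%N -> (n <= k)%N -> z ^+ (2 ^ k) = 1.
    move=> n_gt0 le_nk; apply/eqP; rewrite -order_dvdn.
    apply: dvdn_trans (order_dvdG (in_setT z)) _.
    by rewrite cardsT card_ord Zp_cast ?dvdn_exp2l// -{1}(expn0 2) ltn_exp2l.
  have genZ n (z : 'Z_n) : z = (1%R : 'Z_n) ^+ z by rewrite Zp_expg mul1n
    valZpK.
  pose a : A := (1%R : 'Z_(2 ^ m1), 1); pose b : A := (1, 1%R : 'Z_(2 ^ m2.+1)).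
  have pairX (u : 'Z_(2 ^ m1)) (v : 'Z_(2 ^ m2.+1)) k : (u, v) ^+ k = (u ^+ k,
    v ^+ k) :> A.
    by elim: k => // k IHk; rewrite !expgS IHk.
  have cA (u v : A) : commute u v.
    by case: u v => [u1 u2] [v1 v2]; congr (_, _); apply: Zp_mulgC.
  have m1_gt0 : (0 < m1)%N by apply: leq_trans m1_ge3.
  apply: (D4_homg m1_ge3 D4 (X := a) (Y := b)).
  - apply/eqP; rewrite eqEsubset subsetT; apply/subsetP => -[u v] _.
    have -> : (u, v) = a ^+ u * b ^+ v.
      by rewrite !pairX !expg1n; congr (_, _); rewrite /= ?mulg1 ?mul1g;
        apply: genZ.
    by rewrite groupM// groupX// mem_gen// !inE eqxx ?orbT.
  - by rewrite pairX (expZ m1)// expg1n.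
  - by rewrite pairX (expZ m2.+1)// expg1n.
  - by apply/centerP; split; rewrite ?inE.
  - by apply/centerP; split; rewrite ?inE.
  rewrite pairX (expZ m1)// expg1n; apply/eqP/commgP/cA.
have aA : abelian [set: A].
  by apply/centsP=> -[u1 u2] _ [v1 v2] _; congr (_, _); apply: Zp_mulgC.
have sGK : G^`(1) \subset 'ker f.
  apply: der1_min; first exact: normal_norm (ker_normal f).
  by rewrite (isog_abelian (first_isog f)) /= fE.
rewrite card_quotient ?normal_norm//.
apply: leq_trans (dvdn_leq (indexg_gt0 _ _) (indexgS G sGK)).
have -> : #|G : 'ker f| = #|[set: A]|.
  by rewrite -fE -(card_isog (first_isog f)) card_quotient ?normal_norm
    ?ker_normal.
rewrite cardsT card_prod !card_ord !Zp_cast// -{1}(expn0 2) ltn_exp2l//.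
exact: leq_trans m1_ge3.
Qed.

(** The relations bound the orders of X and Y from above; since their product set has at least the
    product of these bounds as cardinal, both orders are exact and the intersection is trivial. *)
Lemma D4_dprod : <[X]> \x <[Y]> = Q /\ #[X] = (2 ^ m1)%N /\ #[Y] = (2 ^
  m2.+1)%N.
Proof.
have leX : #[X] <= 2 ^ m1 by rewrite dvdn_leq ?expn_gt0// order_dvdn D4_oX.
have leY : #[Y] <= 2 ^ m2.+1 by rewrite dvdn_leq ?expn_gt0// order_dvdn D4_oY.
have leXY := leq_mul leX leY.
have TI : <[X]> :&: <[Y]> = 1.
  apply: cardMg_TI; rewrite D4_quotient -!orderE.
  exact: leq_trans leXY D4_card_quotient.
have cXY : <[Y]> \subset 'C(<[X]>).
  apply: (sub_abelian_cent2 (der_abelian 0 G));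
    by rewrite cycle_subG mem_quotient ?inE.
split; first by rewrite dprodE// D4_quotient.
have := D4_card_quotient; rewrite -D4_quotient (TI_cardMg TI) -!orderE => geXY.
have X0 := order_gt0 X; have Y0 := order_gt0 Y.
have p0 k : 0 < 2 ^ k by rewrite expn_gt0.
split; apply/eqP; rewrite eqn_leq ?leX ?leY /=.
  rewrite -(leq_pmul2r (p0 m2.+1)); apply: leq_trans geXY _.
  by rewrite leq_mul2l leY orbT.
rewrite -(leq_pmul2l (p0 m1)); apply: leq_trans geXY _.
by rewrite leq_mul2r leX orbT.
Qed.

(** Each of the two cyclic factors has order at least 8 and so contributes 2^n elements. The cases n
    = 1 and n = 2 give the 4 and 16 that feed [card_small_cycles]. *)
Lemma D4_card_Ldiv n : n <= 2 -> #|'Ldiv_(2 ^ n)(Q)| = (2 ^ n * 2 ^ n)%N.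
Proof.
move=> n_le2; have [defQ [oX oY]] := D4_dprod.
have pQ : 2.-group Q by rewrite quotient_pgroup// D4_pgroup.
have aQ : abelian Q := der_abelian 0 G.
rewrite -(OhmEabelian pQ) ?(abelianS (Ohm_sub _ _))//.
rewrite -(dprod_card (Ohm_dprod n defQ)).
have pX : 2.-elt X by rewrite /p_elt oX pnatX pnat_id.
have pY : 2.-elt Y by rewrite /p_elt oY pnatX pnat_id.
have ohm z k : 2.-elt z -> #[z] = (2 ^ k)%N -> (n <= k)%N ->
  #|'Ohm_n(<[z]>)| = (2 ^ n)%N.
  move=> pz oz le_nk; rewrite (Ohm_p_cycle n pz) -orderE oz pfactorK//.
  by rewrite orderXdiv oz ?dvdn_exp2l ?leq_subr// -expnB ?leq_subr// subKn.
rewrite (ohm _ X _ pX oX) ?(ohm _ Y _ pY oY)//.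
  exact: leq_trans n_le2 (leqW (ltnW m2_ge3)).
exact: leq_trans n_le2 (ltnW m1_ge3).
Qed.

End AbelianizationD4.

Local Open Scope ring_scope.

(** * Central idempotents and Wedderburn decompositions *)

Section CentralIdempotents.

Variables (K : fieldType) (A : falgType K).
Implicit Types (e u v : A) (V : {vspace A}).

Lemma two_sided_idealP (U V : {vspace A}) :
  reflect [/\ (V <= U)%VS, {in U & V, forall u v, u * v \in V}
            & {in U & V, forall u v, v * u \in V}]
    (two_sided_ideal U V).
Proof.
apply: (iffP and3P) => [[sVU /prodvP sl /prodvP sr]|[sVU sl sr]].
  by split=> // u v Uu Vv; apply: sr.
by split=> //; apply/prodvP => // u v Uu Vv; apply: sr.
Qed.

Lemma simple_ideal_eq (B B' : {aspace A}) :
    two_sided_ideal fullv B -> two_sided_ideal fullv B' ->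
    simple_algebra B -> simple_algebra B' ->
  (B :&: B')%VS != 0%VS -> B = B' :> {vspace A}.
Proof.
move=> /two_sided_idealP[_ Bl Br] /two_sided_idealP[_ Bl' Br'] sB sB' nz.
have idI (C : {vspace A}) : (B :&: B' <= C)%VS -> two_sided_ideal C (B :&: B').
  move=> sIC; apply/two_sided_idealP; split=> // u v _ /memv_capP[Bv Bv'].
    by rewrite memv_cap Bl ?Bl' ?memvf.
  by rewrite memv_cap Br ?Br' ?memvf.
case: (sB _ (idI _ (capvSl _ _))) nz => [-> /eqP //|eB _].
case: (sB' _ (idI _ (capvSr _ _))) => [eI|]; last by rewrite eB.
by have:= not_asubv0 B; rewrite -eB eI sub0v.
Qed.

(** Decompose the unit of B i along the B' j and multiply by it: the parts fall in the intersections
    of B i with the B' j, so one of these is nonzero and B i is that B' j. Directness makes the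
    assignment injective. *)
Lemma leq_wedderburn n k (B : 'I_n -> {aspace A}) (B' : 'I_k -> {aspace A}) :
  wedderburn_decomposition B -> wedderburn_decomposition B' -> (n <= k)%N.
Proof.
move=> [[_ dB iB] sB] [[fB' _ iB'] sB'].
have ex i : {j | B i = B' j :> {vspace A}}.
  have /sigW[j /eqP eqB]: exists j, B i == B' j :> {vspace A}; last by exists j.
  apply/existsP; apply: contraT => /existsPn neB.
  have zI j : (B i :&: B' j)%VS = 0%VS.
    by apply/eqP; apply: contraR (neB j) => /simple_ideal_eq->.
  have /memv_sumP[v Bv]: algid (B i) \in (\sum_j B' j)%VS by rewrite fB' memvf.
  move/(congr1 ( *%R (algid (B i)))); rewrite algidl ?memv_algid// mulr_sumr.
  move=> e0; have:= algid_neq0 (B i); rewrite e0 big1 ?eqxx// => j _.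
  apply/eqP; rewrite -memv0 -(zI j) memv_cap.
  have /two_sided_idealP[_ _ ->] := iB i; rewrite ?memvf ?memv_algid//=.
  by have /two_sided_idealP[_ Bl _] := iB' j; apply: Bl; rewrite ?memvf ?Bv.
rewrite -[n]card_ord -[k in (_ <= k)%N]card_ord.
apply: (leq_card (fun i => sval (ex i))) => i i'.
move=> eqj; apply/eqP; apply: contraT => nii'.
have eqB: B i = B i' :> {vspace A}.
  by rewrite (svalP (ex i)) (svalP (ex i')) eqj.
have /directv_sumP/(_ i isT) := dB; rewrite (bigD1 i') 1?eq_sym//= -eqB.
move/eqP; rewrite -subv0 => /(subv_trans _) => sub0.
by have:= not_asubv0 (B i); rewrite sub0// subv_cap subvv addvSl.
Qed.

(** For a central idempotent e the image A e is closed under products with unit e, so the default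
    value of [insubd] does not occur. *)
Definition principal_ideal e : {aspace A} :=
  insubd (1%AS : {aspace A}) (limg (amulr e)).

Record central_idempotent e : Prop := CentralIdempotent {
  cidem_central : forall u, u * e = e * u;
  cidem_idem : e * e = e;
  cidem_neq0 : e != 0 }.

Lemma memv_limg_idem (D : {vspace A}) e u :
  e * e = e -> u \in (amulr e @: D)%VS -> u * e = u.
Proof. by move=> ee /memv_imgP[v _ ->]; rewrite lfunE /= -mulrA ee. Qed.

Lemma cideal_aspace e : central_idempotent e -> is_aspace (limg (amulr e)).
Proof.
case=> ce ee e0; have le u : u \in limg (amulr e) -> u * e = u.
  exact: memv_limg_idem.
apply/andP; split.
  apply/has_algidP; exists e; split=> //; last first.
    by move=> u Vu; rewrite -ce !le.
  by apply/memv_imgP; exists e; rewrite ?memvf// lfunE /= ee.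
apply/prodvP=> u v /le eu /le ev.
by apply/memv_imgP; exists (u * v); rewrite ?memvf// lfunE /= -mulrA ev.
Qed.

Lemma memv_principal e u :
  central_idempotent e -> (u \in principal_ideal e) = (u * e == u).
Proof.
move=> ce; rewrite /principal_ideal insubdK; last exact: cideal_aspace.
apply/idP/eqP => [|<-]; first exact: memv_limg_idem (cidem_idem ce).
by apply/memv_imgP; exists u; rewrite ?memvf// lfunE.
Qed.

Lemma algid_principal e :
  central_idempotent e -> algid (principal_ideal e) = e.
Proof.
move=> ce; have ee: e \in principal_ideal e.
  by rewrite memv_principal// cidem_idem.
rewrite -[RHS](algidr ee) -(cidem_central ce); apply/esym/eqP.
by rewrite -memv_principal// memv_algid.
Qed.

Lemma principal_ideal_two_sided e :
  central_idempotent e -> two_sided_ideal fullv (principal_ideal e).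
Proof.
move=> ce; apply/two_sided_idealP; split; first exact: subvf.
  by move=> u v _; rewrite !memv_principal// -mulrA => /eqP->.
move=> u v _; rewrite !memv_principal// => /eqP ev.
by rewrite -mulrA (cidem_central ce) mulrA ev.
Qed.

Lemma principal_ideal_direct_sum (I : finType) (e : I -> A) :
    (forall i, central_idempotent (e i)) ->
    (forall i j, i != j -> e i * e j = 0) -> \sum_i e i = 1 ->
  ideal_direct_sum (fun i => principal_ideal (e i)).
Proof.
move=> ce oe e1; split; last by move=> i; apply: principal_ideal_two_sided.
  apply/eqP; rewrite eqEsubv subvf /=; apply/subvP=> u _.
  rewrite -[u]mulr1 -e1 mulr_sumr; apply: memv_sumr => i _.
  by rewrite memv_principal// -mulrA cidem_idem.
apply/directv_sum_independent => u Vu su0 i _.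
have /eqP: (\sum_j u j) * e i = 0 by rewrite su0 mul0r.
rewrite mulr_suml (bigD1 i)//= big1 ?addr0 => [|j nji].
  by have:= Vu i isT; rewrite memv_principal// => /eqP-> /eqP.
have:= Vu j isT; rewrite memv_principal// => /eqP<-.
by rewrite -mulrA oe ?mulr0.
Qed.

Lemma number_of_simple_components_wedderburn n (B : 'I_n -> {aspace A}) :
  wedderburn_decomposition B -> number_of_simple_components A n.
Proof.
move=> wB k; split=> [[B' wB']|->]; last by exists B.
by apply/eqP; rewrite eqn_leq (leq_wedderburn wB wB') (leq_wedderburn wB' wB).
Qed.

Lemma field_algebra_simple (U : {aspace A}) : field_algebra U ->
  simple_algebra U.
Proof.
case=> cU fU V /two_sided_idealP[sVU Vl Vr].
have [->|nzV] := eqVneq V 0%VS; [by left | right].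
apply/eqP; rewrite eqEsubv sVU /=; apply/subvP=> u Uu.
have [|w Uw pw] := fU (vpick V) (subvP sVU _ (memv_pick V)).
  by rewrite vpick0.
rewrite -(algidr Uu) -pw Vl// Vr//; exact: memv_pick.
Qed.

End CentralIdempotents.

Section PrimitiveIdempotents.

Variables (K : fieldType) (A : falgType K) (V : {vspace A}).
Implicit Types (e f u v : A) (s : seq A).

Record primitive_idempotent e : Prop := PrimitiveIdempotent {
  prim_mem : e \in V;
  prim_idem : e * e = e;
  prim_neq0 : e != 0;
  prim_min : forall f, f \in V -> f * f = f -> f * e = 0 \/ f * e = e }.

Hypothesis comV : {in V &, commutative *%R}.
Hypothesis mulV : {in V &, forall u v, u * v \in V}.

Let orthogonal u v := u * v == 0.

(** If f is not primitive, some idempotent g of V splits it into the orthogonal idempotents g f and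
    f - g f, each of which spans with V a proper subspace of V f; hence the induction on the
    dimension of V f. *)
Lemma primitive_idempotent_sum f : f \in V -> f * f = f ->
  exists s, [/\ forall e, e \in s -> primitive_idempotent e,
                pairwise orthogonal s & \sum_(e <- s) e = f].
Proof.
have [m] := ubnP (\dim (amulr f @: V)); elim: m f => // m IHm f ltfm Vf ff.
have [->|nzf] := eqVneq f 0; first by exists [::]; rewrite big_nil; split.
(* Primitivity quantifies over V, which may be infinite; hence the classical case distinction. *)
case: (classic (primitive_idempotent f)) => [pf|npf].
  by exists [:: f]; rewrite big_seq1; split=> // e; rewrite inE => /eqP->.
have [g [Vg gg gf0 gf1]] :
    exists g, [/\ g \in V, g * g = g, g * f != 0 & g * f != f].
  apply: NNPP => ng; apply: npf; split=> // g Vg gg.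
  have [->|g0] := eqVneq (g * f) 0; [by left | right].
  by apply: NNPP => /eqP g1; apply: ng; exists g.
have cgf : f * g = g * f by apply: comV.
have dim_lt h : h \in V -> h * f = h -> h != f -> h * h = h ->
    (\dim (amulr h @: V) < m)%N.
  move=> Vh hf nhf hh; apply: (@leq_trans (\dim (amulr f @: V))) => //.
  rewrite (ltn_leqif (dimv_leqif_sup _)).
    apply: contra nhf => /subvP/(_ f); rewrite -{1}ff => /(_ _)/memv_imgP.
    case=> [|v Vv]; first by apply/memv_imgP; exists f; rewrite ?lfunE.
    by rewrite lfunE /= => fE; rewrite -hf (comV Vh Vf) fE -mulrA hh.
  apply/subvP=> _ /memv_imgP[v Vv ->]; rewrite lfunE /=.
  by apply/memv_imgP; exists (v * h); rewrite ?mulV// lfunE /= -mulrA hf.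
set h1 := g * f; set h2 := f - h1.
have Vh1 : h1 \in V by rewrite mulV.
have Vh2 : h2 \in V by rewrite rpredB.
have h1f : h1 * f = h1 by rewrite -mulrA ff.
have fh1 : f * h1 = h1 by rewrite comV.
have h11 : h1 * h1 = h1 by rewrite {1}/h1 -mulrA fh1 mulrA gg.
have h12 : h1 * h2 = 0 by rewrite mulrBr h1f h11 subrr.
have h22 : h2 * h2 = h2 by rewrite {1}/h2 mulrBl h12 subr0 mulrBr ff fh1.
have [|//|//|s1 [ps1 os1 ss1]] := IHm h1; first exact: dim_lt.
have [|//|//|s2 [ps2 os2 ss2]] := IHm h2.
  apply: dim_lt => //; first by rewrite mulrBl ff h1f.
  by rewrite -subr_eq0 /h2 addrC addKr oppr_eq0.
have sum_id s e : (forall e', e' \in s -> primitive_idempotent e') ->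
    pairwise orthogonal s -> e \in s -> e * \sum_(e' <- s) e' = e.
  elim: s => //= a s IHs ps /andP[/allP oa os]; rewrite inE big_cons mulrDr.
  have pa : primitive_idempotent a by apply: ps; rewrite mem_head.
  case/orP=> [/eqP->|se].
    rewrite (prim_idem pa) mulr_sumr big_seq big1 ?addr0// => e' /oa.
    by move/eqP.
  have pe : primitive_idempotent e by apply: ps; rewrite inE se orbT.
  have /eqP := oa e se; rewrite (comV (prim_mem pa) (prim_mem pe)) => ->.
  by rewrite add0r IHs// => e' se'; apply: ps; rewrite inE se' orbT.
exists (s1 ++ s2); split=> [e||]; last by rewrite big_cat /= ss1 ss2 addrC
  subrK.
  by rewrite mem_cat => /orP[/ps1|/ps2].
(* Since e1 = e1 h1 and e2 = e2 h2, the product e1 e2 contains the factor h1 h2 = 0. *)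
rewrite pairwise_cat os1 os2 !andbT; apply/allrelP=> e1 e2 se1 se2.
rewrite /orthogonal -(sum_id _ _ ps1 os1 se1) -(sum_id _ _ ps2 os2 se2) ss1 ss2.
rewrite -mulrA (mulrA h1) (comV Vh1 (prim_mem (ps2 _ se2))) -(mulrA e2).
by rewrite h12 !mulr0.
Qed.

(** When every V e is the line K e, the orthogonal primitive idempotents that sum to the unit f span
    V; being independent, they number dim V. *)
Lemma split_decomposition f : f \in V -> f * f = f ->
    {in V, forall v, v * f = v} ->
    (forall e v, primitive_idempotent e -> v \in V -> v * e \in <[e]>%VS) ->
  exists e : 'I_(\dim V) -> A,
    [/\ forall i, primitive_idempotent (e i),
        forall i j, i != j -> e i * e j = 0 & \sum_i e i = f].
Proof.
move=> Vf ff f1 splitV.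
have [s [ps os ss]] := primitive_idempotent_sum Vf ff.
have ps' (i : 'I_(size s)) : primitive_idempotent s`_i by apply: ps;
  apply: mem_nth.
have orth (i j : 'I_(size s)) : i != j -> s`_i * s`_j = 0.
  move=> nij; have /(pairwiseP 0) oP := os.
  have [ltij|ltji|eqij] := ltngtP i j; last by rewrite -val_eqE /= eqij eqxx in
    nij.
    by apply/eqP/oP; rewrite ?inE.
  rewrite (comV (prim_mem (ps' _)) (prim_mem (ps' _))).
  by apply/eqP/oP; rewrite ?inE.
suff /eqP dimV: \dim V == size s.
  rewrite dimV; exists (fun i => s`_i); split=> //.
  by rewrite -ss (big_nth 0) big_mkord.
have freeS : free s.
  rewrite -[s]in_tupleE; apply/freeP => k /= sk0 i.
  have: (\sum_j k j *: s`_j) * s`_i = 0 by rewrite sk0 mul0r.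
  rewrite mulr_suml (bigD1 i)//= big1 ?addr0 => [|j nji]; last first.
    by rewrite -scalerAl orth ?scaler0.
  rewrite -scalerAl (prim_idem (ps' i)) => /eqP.
  by rewrite scaler_eq0 (negPf (prim_neq0 (ps' i))) orbF => /eqP.
rewrite -(eqP freeS); apply/eqP; congr (\dim _); apply/eqP.
rewrite eqEsubv; apply/andP; split; last first.
  by apply/span_subvP => e /ps /prim_mem.
apply/subvP=> v Vv; rewrite -(f1 v Vv) -ss mulr_sumr big_seq rpred_sum// =>
  e se.
have /vlineP[k ->] := splitV _ _ (ps e se) Vv.
by rewrite rpredZ// memv_span.
Qed.

End PrimitiveIdempotents.

(** * Twisted subalgebras of the group algebra *)

Section ReducedAlgebra.

Variables (K : fieldType) (A : falgType K) (D : {vspace A}).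
Hypothesis comD : {in D &, commutative *%R}.
Hypothesis mulD : {in D &, forall u v, u * v \in D}.
Hypothesis redD : {in D, forall u, u * u = 0 -> u = 0}.

(* u A = u^2 A in a reduced finite-dimensional commutative algebra; writing
   u = d u^2, the element d u is idempotent. *)
Lemma reduced_primitive_inverse e u : primitive_idempotent D e ->
  u \in D -> u * e != 0 -> exists2 w, w \in D & u * w * e = e.
Proof.
case=> De ee e0 pe Du xn0; set x := u * e.
have Dx : x \in D by rewrite mulD.
have /memv_imgP[_ /memv_imgP[d Dd ->]] : x \in (amulr x @: (amulr x @: D))%VS.
  have injx : (amulr x @: D :&: lker (amulr x))%VS = 0%VS.
    apply/eqP; rewrite -subv0; apply/subvP=> _ /memv_capP[/memv_imgP[v Dv ->]].
    rewrite memv_ker memv0 !lfunE /= => /eqP vxx; apply/eqP/redD.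
      by rewrite mulD.
    by rewrite {2}(comD Dv Dx) mulrA vxx mul0r.
  suff -> : (amulr x @: (amulr x @: D) = amulr x @: D)%VS.
    by apply/memv_imgP; exists e; rewrite // lfunE /= comD// -mulrA ee.
  apply/eqP; rewrite eqEdim (limg_dim_eq injx) leqnn andbT.
  apply/subvP=> _ /memv_imgP[_ /memv_imgP[v Dv ->] ->].
  by apply/memv_imgP; exists (v * x); rewrite ?mulD// !lfunE.
rewrite !lfunE /= => xE.
have Dg : d * x \in D by rewrite mulD.
have gg : (d * x) * (d * x) = d * x.
  by rewrite mulrA -(mulrA d x d) (comD Dx Dd) -mulrA -xE.
have gx : (d * x) * x = x by rewrite -xE.
case: (pe _ Dg gg) => ge; last first.
  by exists d => //; rewrite (comD Du Dd) -[RHS]ge /x -!mulrA ee.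
by case/eqP: xn0; rewrite -/x -gx {2}/x (comD Du De) mulrA ge mul0r.
Qed.

End ReducedAlgebra.

Section GroupAlgebraBasis.

Variables (K : fieldType) (gT : finGroupType).
Local Notation KG := (group_algebra K gT).
Implicit Types (u v : KG) (g h a : gT).

Definition delta g : KG := [ffun a => (a == g)%:R].

Lemma ga_mulE u v a : (u * v) a = \sum_b u b * v (b^-1 * a)%g.
Proof. by rewrite ffunE. Qed.

Lemma ga_sum (I : Type) (r : seq I) (P : pred I) (F : I -> KG) a :
  (\sum_(i <- r | P i) F i) a = \sum_(i <- r | P i) F i a.
Proof. by elim/big_rec2: _ => [|i x y _ <-]; rewrite ffunE. Qed.

Lemma ga_scaleE (c : K) u a : (c *: u) a = c * u a.
Proof. by rewrite ffunE. Qed.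

Lemma delta1 : delta 1 = 1.
Proof. by apply/ffunP=> a; rewrite !ffunE. Qed.

Lemma delta_mull g u a : (delta g * u) a = u (g^-1 * a)%g.
Proof.
rewrite ga_mulE (bigD1 g)//= ffunE eqxx mul1r big1 ?addr0// => b /negPf nb.
by rewrite ffunE nb mul0r.
Qed.

Lemma delta_mulr g u a : (u * delta g) a = u (a * g^-1)%g.
Proof.
rewrite ga_mulE (bigD1 (a * g^-1)%g)//= ffunE invMg invgK mulgKV eqxx mulr1.
rewrite big1 ?addr0// => b nb; rewrite ffunE; case: eqP => [gE|];
  last by rewrite mulr0.
by case/eqP: nb; rewrite -gE invMg invgK mulKVg.
Qed.

Lemma delta_mul g h : delta g * delta h = delta (g * h).
Proof.
by apply/ffunP=> a; rewrite delta_mull !ffunE -(inj_eq (mulgI g)) mulKVg.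
Qed.

Lemma ga_decomp u : u = \sum_g u g *: delta g.
Proof.
apply/ffunP=> a; rewrite ga_sum (bigD1 a)//= !ffunE eqxx big1 ?addr0;
  last first.
  by move=> b /negPf nb; rewrite !ffunE eq_sym nb; apply: mulr0.
exact: esym (mulr1 _).
Qed.

Lemma ga_central u : (forall g, delta g * u = u * delta g) ->
  forall v, v * u = u * v.
Proof.
move=> cu v; rewrite (ga_decomp v) mulr_suml mulr_sumr; apply: eq_bigr => g _.
by rewrite -scalerAl -scalerAr cu.
Qed.

(** Both the twisting condition under s, including the vanishing off H, and the invariance under a
    power map are systems of equations of this shape. *)
Definition relation_space (I : finType) (c : I -> K) (f1 f2 : I -> gT) :
    {vspace KG} :=
  (\bigcap_i lker (linfun (fun u : KG => (u (f1 i) - c i * u (f2 i) :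
    K^o))))%VS.

Lemma relation_spaceP (I : finType) (c : I -> K) (f1 f2 : I -> gT) u :
  reflect (forall i, u (f1 i) = c i * u (f2 i)) (u \in relation_space c f1 f2).
Proof.
have lin i : linear (fun u : KG => (u (f1 i) - c i * u (f2 i) : K^o)).
  move=> k v w; rewrite !ffunE /= mulrDr opprD addrACA -[k *: (_ : K^o)]/(k *
    _).
  by rewrite mulrBr mulrCA.
pose F i : {linear KG -> K^o} := HB.pack (fun u : KG =>
  (u (f1 i) - c i * u (f2 i) : K^o))
  (GRing.isLinear.Build K KG K^o *:%R _ (lin i)).
have memF i : (u \in lker (linfun (F i))) = (u (f1 i) == c i * u (f2 i)).
  by rewrite memv_ker lfunE /= subr_eq0.
rewrite memvE; apply: (iffP subv_bigcapP) => [Vu i|Vu i _].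
  by apply/eqP; rewrite -memF memvE Vu.
by rewrite -memvE memF; apply/eqP.
Qed.

(** The linear extension of g |-> g^r. It is not multiplicative on KG in general, but it is so on
    the twisted subalgebras when r is odd. *)
Definition power_sum (r : nat) u : KG := \sum_g u g *: delta (g ^+ r).

Fact power_sum_is_linear r : linear (power_sum r).
Proof.
move=> k u v; rewrite /power_sum scaler_sumr -big_split; apply: eq_bigr => g _.
by rewrite !ffunE scalerDl scalerA.
Qed.
HB.instance Definition _ r :=
  GRing.isLinear.Build K KG KG *:%R (power_sum r) (@power_sum_is_linear r).

Lemma power_sum_delta r g : power_sum r (delta g) = delta (g ^+ r).
Proof.
rewrite /power_sum (bigD1 g)//= ffunE eqxx scale1r big1 ?addr0// => h /negPf nh.
by rewrite ffunE nh scale0r.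
Qed.

Lemma power_sumX r u a : coprime #|[set: gT]| r ->
  power_sum r u (a ^+ r)%g = u a.
Proof.
move=> co; rewrite /power_sum ga_sum (bigD1 a)//= !ffunE eqxx big1 ?addr0.
  by rewrite -[RHS]mulr1.
move=> b /negPf nb; rewrite !ffunE -[RHS](mulr0 (u b)); congr (_ * _).
case: eqP => // /(congr1 (fun x => x ^+ expg_invn [set: gT] r)%g).
by rewrite !expgK ?inE// => /eqP; rewrite eq_sym nb.
Qed.

Lemma power_sum_fixP r u : coprime #|[set: gT]| r ->
  power_sum r u = u <-> forall a, u (a ^+ r)%g = u a.
Proof.
move=> co; split=> [pu a|ur]; first by rewrite -{1}pu power_sumX.
apply/ffunP=> a; rewrite -[a](@expgK _ [set: gT]%G r) ?inE//.
by rewrite -expgM mulnC expgM power_sumX// ur.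
Qed.

Lemma power_sum_inj r : coprime #|[set: gT]| r -> injective (power_sum r).
Proof.
move=> co u v eq_uv; apply/ffunP=> a.
by rewrite -(power_sumX u a co) eq_uv power_sumX.
Qed.

End GroupAlgebraBasis.

(** For s central in G with s^2 = 1, s in H and l = 1 or -1, this is K[H] (1 + l s)/2; the choice s
    = 1, l = 1 gives K[H] itself. *)
Definition twisted (K : fieldType) (gT : finGroupType) (H : {set gT}) (s : gT)
    (l : K) : {vspace group_algebra K gT} :=
  relation_space (fun a => (a \in H)%:R * l) id (fun a => s * a)%g.

HB.lock Definition twist (K : fieldType) (gT : finGroupType) (s : gT) (l : K) (h
  : gT) :
    group_algebra K gT :=
  2%:R^-1 *: (delta K h + l *: delta K (s * h)%g).

(** P lists the exponents: [[:: q]] over a field with q elements, the odd r below the order of G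
    over the rationals. *)
Definition twisted_fix (K : fieldType) (gT : finGroupType) (H : {set gT}) (s :
  gT)
    (l : K) (P : seq nat) : {vspace group_algebra K gT} :=
  (twisted H s l :&: \bigcap_(r <- P) relation_space (fun _ : gT => 1%R)
     (fun a => a ^+ r)%g id)%VS.

(** [td_comm] makes D commutative although H need not be: a commutator s acts on D as the scalar l =
    1. *)
Record twist_data (K : fieldType) (gT : finGroupType) (H : {set gT}) (s : gT)
    (l : K) : Prop := TwistData {
  td_mem : s \in H;
  td_central : forall g, commute s g;
  td_square : (s * s = 1)%g;
  td_sign : l * l = 1;
  td_two : 2%:R != 0 :> K;
  td_comm : {in H &, forall g h, [~ g, h]%g = 1%g \/ ([~ g,
    h]%g = s /\ l = 1)} }.

Section Twisted.

Variables (K : fieldType) (gT : finGroupType) (H : {group gT}) (s : gT) (l : K).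
Local Notation KG := (group_algebra K gT).
Local Notation D := (twisted H s l).
Local Notation E := (twist s l).
Implicit Types (u v : KG) (g h a : gT) (r n : nat).

Lemma twistedP u :
  reflect (forall a, u a = if a \in H then l * u (s * a)%g else 0) (u \in D).
Proof.
apply: (iffP (relation_spaceP _ _ _ _)) => Du a; rewrite Du /=.
  by case: ifP; rewrite ?mul1r// !mul0r.
by case: ifP; rewrite ?mul1r// !mul0r.
Qed.

Lemma twisted_fixP (P : seq nat) u :
  reflect (u \in D /\ {in P, forall r a, u (a ^+ r)%g = u a})
    (u \in twisted_fix H s l P).
Proof.
rewrite /twisted_fix memv_cap; apply: (iffP andP) => -[-> Pu]; split=> //.
  elim: P Pu => // r P IHP; rewrite big_cons memv_cap =>
    /andP[/relation_spaceP rP].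
  move=> /IHP{}IHP r'; rewrite inE => /orP[/eqP->|/IHP//] a.
  by rewrite rP mul1r.
elim: P Pu => [|r P IHP] Pu; first by rewrite big_nil memvf.
rewrite big_cons memv_cap IHP ?andbT => [|r' Pr']; last first.
  by apply: Pu; rewrite inE Pr' orbT.
by apply/relation_spaceP=> a; rewrite mul1r Pu ?mem_head.
Qed.

Hypothesis tw : twist_data H s l.
Let sH := td_mem tw.
Let sC := td_central tw.
Let ss := td_square tw.
Let ll := td_sign tw.
Let two := td_two tw.
Let abH := td_comm tw.

Lemma twisted_s u h : u \in D -> u (s * h)%g = l * u h.
Proof.
move=> /twistedP Du; rewrite Du groupMl// mulgA ss mul1g; case: ifP => // nHh.
by rewrite Du nHh mulr0.
Qed.

Lemma twisted_supp u h : u \in D -> h \notin H -> u h = 0.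
Proof. by move=> /twistedP-> /negPf->. Qed.

Lemma twist_ffunE h a :
  E h a = 2%:R^-1 * ((a == h)%:R + l * (a == s * h)%g%:R).
Proof. by rewrite twist.unlock ga_scaleE ffunE ga_scaleE !ffunE. Qed.

Lemma twist_mul g h : E g * E h = E (g * h).
Proof.
rewrite !twist.unlock -scalerAl -scalerAr; congr (_ *: _).
have gs : (g * (s * h) = s * (g * h))%g by rewrite !mulgA -sC.
rewrite mulrDl !mulrDr -!scalerAl -!scalerAr !delta_mul -!mulgA gs scalerA ll.
rewrite (mulgA s s) ss mul1g scale1r [X in _ + X]addrC -mulr2n -scaler_nat
  scalerA.
by rewrite mulVf// scale1r.
Qed.

Lemma twist_s h : E (s * h) = l *: E h.
Proof.
rewrite !twist.unlock mulgA ss mul1g [RHS]scalerA mulrC -[RHS]scalerA.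
by congr (_ *: _); rewrite scalerDr scalerA ll scale1r addrC.
Qed.

Lemma twist_in h : h \in H -> E h \in D.
Proof.
move=> Hh; apply/twistedP=> a; rewrite !twist_ffunE.
have seq b c : (s * b == s * c)%g = (b == c) by rewrite (inj_eq (mulgI s)).
have seq' b c : (s * b == c)%g = (b == s * c)%g by rewrite -seq mulgA ss mul1g.
case: ifP => [_|/negP nHa].
  rewrite seq seq' mulrCA; congr (_ * _).
  by rewrite mulrDr mulrA ll mul1r addrC.
have -> : (a == h) = false by apply/eqP=> ah; rewrite ah in nHa.
have -> : (a == s * h)%g = false by apply/eqP=> ah; rewrite ah groupM in nHa.
by rewrite mulr0 addr0 mulr0.
Qed.

Lemma twist_swap g h : g \in H -> h \in H -> E (g * h) = E (h * g).
Proof.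
move=> Hg Hh; rewrite (commgC g h).
case: (abH Hg Hh) => [->|[-> l1]]; first by rewrite mulg1.
by rewrite -sC twist_s l1 scale1r.
Qed.

Lemma twisted_decomp u : u \in D -> u = \sum_h u h *: E h.
Proof.
move=> Du; apply/ffunP=> a; rewrite ga_sum.
have sumd b : \sum_h u h * (b == h)%:R = u b.
  rewrite (bigD1 b)//= eqxx mulr1 big1 ?addr0// => h /negPf nh.
  by rewrite eq_sym nh mulr0.
have -> : \sum_h (u h *: E h) a = 2%:R^-1 * (u a + l * u (s * a)%g).
  rewrite -(sumd a) -(sumd (s * a)%g) mulr_sumr -big_split mulr_sumr /=.
  apply: eq_bigr => h _; rewrite ga_scaleE twist_ffunE mulrCA mulrDr.
  rewrite [l * (_ * _)]mulrCA -[(s * a == h)%g](inj_eq (mulgI s)).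
  by rewrite mulgA ss mul1g.
rewrite (twisted_s _ Du).
have half (c : K) : c = 2%:R^-1 * (c + l * (l * c)).
  by rewrite mulrA ll mul1r -mulr2n -[c *+ 2]mulr_natl mulrA mulVf// mul1r.
exact: half.
Qed.

Lemma twisted_decompH u : u \in D -> u = \sum_(h in H) u h *: E h.
Proof.
move=> Du; rewrite {1}(twisted_decomp Du) (bigID (mem H)) /=.
by rewrite addrC big1 ?add0r// => h nHh; rewrite twisted_supp ?scale0r.
Qed.

Lemma twisted_mul : {in D &, forall u v, u * v \in D}.
Proof.
move=> u v Du Dv; rewrite (twisted_decompH Du) (twisted_decompH Dv) mulr_suml.
apply: rpred_sum => g Hg; rewrite mulr_sumr; apply: rpred_sum => h Hh.
by rewrite -scalerAl -scalerAr !rpredZ// twist_mul twist_in ?groupM.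
Qed.

Lemma twisted_comm : {in D &, commutative *%R}.
Proof.
move=> u v Du Dv; rewrite (twisted_decompH Du) (twisted_decompH Dv).
rewrite mulr_suml mulr_sumr; apply: eq_bigr => g Hg.
rewrite mulr_suml mulr_sumr; apply: eq_bigr => h Hh.
rewrite -!scalerAl -!scalerAr !twist_mul (twist_swap Hg Hh) scalerA
  [RHS]scalerA.
by rewrite mulrC.
Qed.

Lemma twist1_in : E 1%g \in D.
Proof. exact: twist_in. Qed.

Lemma twist1_idem : E 1%g * E 1%g = E 1%g.
Proof. by rewrite twist_mul mulg1. Qed.

Lemma twisted_mulr1 : {in D, forall u, u * E 1%g = u}.
Proof.
move=> u Du; rewrite {1}(twisted_decomp Du) mulr_suml [RHS](twisted_decomp Du).
by apply: eq_bigr => h _; rewrite -scalerAl twist_mul mulg1.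
Qed.

Lemma twist_delta h : delta K h * E 1%g = E h.
Proof.
by rewrite !twist.unlock -scalerAr mulrDr -scalerAr !delta_mul !mulg1 -sC.
Qed.

Lemma twist1_central u : u * E 1%g = E 1%g * u.
Proof.
move: u; apply: ga_central => g; rewrite !twist.unlock -scalerAr -scalerAl;
  congr (_ *: _).
by rewrite mulrDr mulrDl -scalerAr -scalerAl !delta_mul !mulg1 mul1g -sC.
Qed.

Lemma twistX h n : (0 < n)%N -> E h ^+ n = E (h ^+ n).
Proof.
case: n => // n _; elim: n => [|n IHn]; first by rewrite expg1.
by rewrite exprS IHn twist_mul -expgS.
Qed.

Lemma twist_expMn g h n : g \in H -> h \in H ->
  E ((g * h) ^+ n) = E (g ^+ n * h ^+ n).
Proof.
move=> Hg Hh; elim: n => [|n IHn]; first by rewrite !expg0 mulg1.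
rewrite expgSr -twist_mul IHn twist_mul mulgA -(mulgA _ _ g) -twist_mul.
rewrite -(twist_mul (g ^+ n)%g) (twist_swap (groupX n Hh) Hg) !twist_mul.
by rewrite !expgSr !mulgA.
Qed.

Lemma power_sum_twist r h : odd r -> power_sum r (E h) = E (h ^+ r)%g.
Proof.
move=> oddr; rewrite !twist.unlock linearZ linearD linearZ /= !power_sum_delta.
congr (_ *: (_ + _ *: delta _ _)); rewrite (expgMn _ (sC h)).
congr (_ * _)%g; rewrite -(odd_double_half r) oddr expgS -muln2 mulnC expgM.
by rewrite expgS expg1 ss expg1n mulg1.
Qed.

Lemma power_sum_twisted r u : odd r -> u \in D ->
  power_sum r u = \sum_h u h *: E (h ^+ r)%g.
Proof.
move=> oddr Du; rewrite {1}(twisted_decomp Du) linear_sum;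
  apply: eq_bigr => h _.
by rewrite linearZ /= power_sum_twist.
Qed.

Lemma power_sum_twisted_in r u : odd r -> u \in D -> power_sum r u \in D.
Proof.
move=> oddr Du; rewrite {1}(twisted_decompH Du) linear_sum;
  apply: rpred_sum => h Hh.
by rewrite linearZ /= power_sum_twist// rpredZ// twist_in// groupX.
Qed.

(** For odd r, s^r = s gives E h |-> E (h^r), and commutativity of D gives E ((g h)^r) = E (g^r
    h^r). *)
Lemma power_sumM r : odd r ->
  {in D &, forall u v, power_sum r (u * v) = power_sum r u * power_sum r v}.
Proof.
move=> oddr u v Du Dv; rewrite (twisted_decompH Du) (twisted_decompH Dv).
rewrite mulr_suml !linear_sum mulr_suml; apply: eq_bigr => g Hg.
rewrite mulr_sumr linear_sum mulr_sumr; apply: eq_bigr => h Hh.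
rewrite -scalerAl -scalerAr !linearZ /= -scalerAl -scalerAr.
by rewrite twist_mul !power_sum_twist// twist_mul twist_expMn.
Qed.

Section Fixed.

Variable P : seq nat.
Local Notation V := (twisted_fix H s l P).
Hypotheses (oddP : {in P, forall r, odd r}).
Hypotheses (coP : {in P, forall r, coprime #|[set: gT]| r}).

Lemma twisted_fix_sub u : u \in V -> u \in D.
Proof. by case/twisted_fixP. Qed.

Lemma twisted_fix_powerP u :
  u \in V <-> u \in D /\ {in P, forall r, power_sum r u = u}.
Proof.
split=> [/twisted_fixP[Du fu]|[Du fu]].
  by split=> // r Pr; apply/power_sum_fixP; [apply: coP | apply: fu].
apply/twisted_fixP; split=> // r Pr.
by apply/power_sum_fixP; [apply: coP | apply: fu].
Qed.

Lemma twisted_fix_mul : {in V &, forall u v, u * v \in V}.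
Proof.
move=> u v /twisted_fix_powerP[Du fu] /twisted_fix_powerP[Dv fv].
apply/twisted_fix_powerP; split=> [|r Pr]; first exact: twisted_mul.
by rewrite power_sumM ?fu ?fv ?oddP.
Qed.

Lemma twisted_fix_comm : {in V &, commutative *%R}.
Proof. by move=> u v /twisted_fix_sub Du /twisted_fix_sub;
  apply: twisted_comm. Qed.

Lemma twist1_fix : E 1%g \in V.
Proof.
apply/twisted_fix_powerP; split=> [|r Pr]; first exact: twist1_in.
by rewrite power_sum_twist ?oddP// expg1n.
Qed.

Lemma twisted_fix_mulr1 : {in V, forall u, u * E 1%g = u}.
Proof. by move=> u /twisted_fix_sub; apply: twisted_mulr1. Qed.

End Fixed.

End Twisted.
Arguments twisted_fix_powerP {K gT H s l P} coP {u}.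

(** * Finite coefficient fields *)

Lemma exprD_pchar_comm (R : nzSemiRingType) (p n : nat) (u v : R) :
  p \in [pchar R] -> GRing.comm u v -> (u + v) ^+ (p ^ n) = u ^+ (p ^ n) + v ^+
    (p ^ n).
Proof.
move=> pR cuv; elim: n => [|n IHn]; first by rewrite !expr1.
rewrite expnSr !exprM IHn -!(pFrobenius_autE pR) pFrobenius_autD_comm//.
exact: commrX (commr_sym (commrX _ (commr_sym _))).
Qed.

Section FiniteField.

Variables (K : finFieldType) (gT : finGroupType) (H : {group gT}) (s : gT) (l :
  K).
Local Notation KG := (group_algebra K gT).
Local Notation D := (twisted H s l).
Local Notation E := (twist s l).
Local Notation q := #|K|.
Local Notation V := (twisted_fix H s l [:: q]).

Hypothesis tw : twist_data H s l.
Hypothesis oddq : odd q.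
Hypothesis coq : coprime #|[set: gT]| q.

Let odd1 : {in [:: q], forall r, odd r}.
Proof. by move=> r; rewrite inE => /eqP->. Qed.
Let co1 : {in [:: q], forall r, coprime #|[set: gT]| r}.
Proof. by move=> r; rewrite inE => /eqP->. Qed.

Lemma twisted_frobenius u : u \in D -> u ^+ q = power_sum q u.
Proof.
move=> Du; rewrite (power_sum_twisted tw oddq Du).
have /is_abelemP[p pr_p /abelem_pgroup pK] := finField_is_abelem K.
have [n qE] : {n | q = (p ^ n)%N} by apply: p_natP; rewrite -cardsT.
have charKG : p \in [pchar KG].
  have pcharK := card_finPcharP qE pr_p.
  by rewrite inE pr_p -scaler_nat (pcharf0 pcharK) scale0r eqxx.
have q_gt0 : (0 < q)%N by rewrite (ltn_trans _ (finNzRing_gt1 K)).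
rewrite {1}(twisted_decompH tw Du) [RHS](bigID (mem H)) /= [X in _ + X]big1
  ?addr0.
  have comE (h : gT) (r : seq gT) : h \in H ->
      GRing.comm (u h *: E h) (\sum_(g <- r | g \in H) u g *: E g).
    move=> Hh; apply: commr_sum => g Hg.
    by apply: (twisted_comm tw); rewrite rpredZ// (twist_in tw).
  elim: (index_enum _) => [|h r IHr]; first by rewrite !big_nil expr0n gtn_eqF.
  rewrite !big_cons; case: ifP => // Hh.
  rewrite {1}qE (exprD_pchar_comm _ charKG (comE h r Hh)) -qE.
  rewrite IHr; congr (_ + _); rewrite exprZn (twistX tw)//.
  by congr (_ *: _); apply: expf_card.
by move=> h nHh; rewrite (twisted_supp Du nHh) scale0r.
Qed.

(** From u^2 = 0 follows u^q = 0; but u^q is the image of u under the power map, which is injective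
    because q is prime to the order of G. *)
Lemma twisted_reduced u : u \in D -> u * u = 0 -> u = 0.
Proof.
move=> Du uu; apply: (power_sum_inj coq); rewrite linear0 -twisted_frobenius//.
by have := finNzRing_gt1 K; case: #|K| => [|[|m]]// _;
  rewrite !exprS mulrA uu mul0r.
Qed.

Lemma idem_twisted_fix e : e \in D -> e * e = e -> e \in V.
Proof.
move=> De ee; apply/(twisted_fix_powerP co1); split=> // r.
rewrite inE => /eqP->; rewrite -twisted_frobenius//.
by have := finNzRing_gt1 K; case: #|K| => // m _; elim: m => // m IHm;
  rewrite exprS IHm.
Qed.

(** An idempotent satisfies u^q = u, so all idempotents of D lie in V, and minimality in V is
    minimality in D, where inverses are sought. *)
Lemma primitive_twisted_fix e : primitive_idempotent V e ->
  primitive_idempotent D e.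
Proof.
case=> Ve ee e0 pe; split=> //; first exact: (twisted_fix_sub Ve).
by move=> f Df ff; apply: pe => //; apply: idem_twisted_fix.
Qed.

Lemma twisted_inverse e u : primitive_idempotent V e ->
  u \in D -> u * e != 0 -> exists2 w, w \in D & u * w * e = e.
Proof.
move=> /primitive_twisted_fix; apply: reduced_primitive_inverse.
- exact: twisted_comm tw.
- exact: twisted_mul tw.
- exact: twisted_reduced.
Qed.

(** If v e were not a scalar multiple of e, every (v - c) e would be nonzero, hence invertible in D
    e, and so would be their product over all c in K; but this product is (v^q - v) e = 0. *)
Lemma twisted_fix_scalar e v : primitive_idempotent V e -> v \in V ->
  v * e \in <[e]>%VS.
Proof.
move=> pe Vv; have Dv := twisted_fix_sub Vv.
have De := twisted_fix_sub (prim_mem pe).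
have E1e : E 1%g * e = e by rewrite (twisted_comm tw) ?(twisted_mulr1 tw)//
  twist1_in.
apply: NNPP => nv.
have step (r : seq K) : horner_alg v (\prod_(c <- r) ('X - c%:P)) * e != 0.
  elim: r => [|c r IHr]; first by rewrite big_nil rmorph1 mul1r (prim_neq0 pe).
  have: (v - c *: E 1%g) * e != 0.
    rewrite mulrBl -scalerAl E1e subr_eq0; apply/eqP=> ve.
    by apply: nv; rewrite ve memvZ ?memv_line.
  have Dvc : v - c *: E 1%g \in D by rewrite rpredB// rpredZ// (twist1_in tw).
  move=> /(twisted_inverse pe Dvc)[w Dw vwe]; apply: contraNneq IHr.
  rewrite big_cons mulrC rmorphM -mulrA rmorphB /= horner_algX horner_algC.
  move/(congr1 (fun x => x * w)); rewrite mul0r => <-; rewrite -{1}vwe.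
  have -> : (v - c%:A) * e = (v - c *: E 1%g) * e.
    by rewrite !mulrBl mulr_algl -scalerAl E1e.
  by rewrite -!mulrA (twisted_comm tw Dw De).
have := step (index_enum K); rewrite -finField_genPoly rmorphB rmorphXn /=.
rewrite horner_algX (twisted_frobenius Dv).
have /(twisted_fix_powerP co1)[_ ->] := Vv; rewrite ?mem_head//.
by rewrite subrr mul0r eqxx.
Qed.

End FiniteField.

(** * Rational coefficients *)

Definition odds (n : nat) : seq nat := [seq r <- iota 0 n | odd r].

Lemma mem_odds n r : (r \in odds n) = odd r && (r < n)%N.
Proof. by rewrite mem_filter mem_iota leq0n add0n. Qed.

(** This is the cyclotomic polynomial of order 2^(j+1): a primitive root of unity of that order is a
    root, and its minimal polynomial has the same degree 2^j. *)
Lemma irreducible_Xpow2_add1 j : irreducible_poly ('X^(2 ^ j) + 1 : {poly rat}).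
Proof.
have n_gt0 : (0 < 2 ^ j)%N by rewrite expn_gt0.
have [z zp] : {z : algC | (2 ^ j.+1).-primitive_root z}.
  by apply: C_prim_root_exists; rewrite expn_gt0.
set p : {poly rat} := _ + 1.
have sz_p : size p = (2 ^ j).+1 by rewrite size_polyDl ?size_polyXn ?size_poly1.
have pz : root (map_poly ratr p) z.
  rewrite rmorphD /= map_polyXn rmorph1 rootE !hornerE.
  have : (z ^+ (2 ^ j)) ^+ 2 == 1 by rewrite -exprM -expnSr prim_expr_order.
  rewrite sqrf_eq1 => /orP[|/eqP->]; last by rewrite addNr eqxx.
  by rewrite -(prim_order_dvd zp) expnS gtnNdvd// ltn_Pmull.
have [q [qE qmon] rq] := minCpolyP z.
have sz_q : size q = (2 ^ j).+1.
  have := congr1 (size \o polyseq) qE; rewrite /= size_map_poly => <-.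
  by rewrite (minCpoly_cyclotomic zp) size_cyclotomic totient_pfactor// mul1n.
have eq_pq : q %= p by rewrite -dvdp_size_eqp ?sz_p ?sz_q// -rq.
split=> [|d szd /dvdpP[c pE]]; first by rewrite sz_p ltnS.
have c0 : c != 0 by apply: contra_eq_neq sz_p => c0;
  rewrite pE c0 mul0r size_poly0.
have d0 : d != 0 by apply: contra_eq_neq sz_p => d0;
  rewrite pE d0 mulr0 size_poly0.
have szM := size_mul c0 d0; rewrite -pE sz_p in szM.
have := pz; rewrite pE rmorphM rootM !rq => /orP[|].
  move=> /(dvdp_leq c0); rewrite sz_q => lec; case/negP: szd.
  rewrite eqn_leq size_poly_gt0 d0 andbT -(leq_add2l (size c)) addn1.
  by rewrite -(ltn_predK (_ : 0 < size c + size d)%N) ?addn_gt0 ?size_poly_gt0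
    ?c0//
     -szM.
move=> qd; rewrite /eqp dvdp_mulIr -pE.
by rewrite -(eqp_dvdl _ eq_pq).
Qed.

Section OddPowerFixed.

Variables (K : fieldType) (gT : finGroupType) (H : {group gT}) (s : gT) (l : K).
Local Notation KG := (group_algebra K gT).
Local Notation D := (twisted H s l).
Local Notation E := (twist s l).
Local Notation n := #|[set: gT]|.
Local Notation V := (twisted_fix H s l (odds n)).
Implicit Types (u v e : KG) (g h : gT).

Hypothesis tw : twist_data H s l.
Hypothesis G2 : (2.-group [set: gT])%g.
Hypothesis Gn1 : (1 < n)%N.

Lemma coprime_odd_card r : odd r -> coprime n r.
Proof.
move=> oddr; have [k ->] := p_natP G2.
by rewrite coprimeXl// coprime2n.
Qed.

Lemma even_card : ~~ odd n.
Proof.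
have [k nE] := p_natP G2; move: Gn1; rewrite nE; case: k {nE} => // k _.
by rewrite oddX.
Qed.

Let odd1 : {in odds n, forall r, odd r}.
Proof. by move=> r; rewrite mem_odds => /andP[]. Qed.
Let co1 : {in odds n, forall r, coprime n r}.
Proof. by move=> r /odd1; apply: coprime_odd_card. Qed.

(** Exponents matter only modulo n, and n is even, so reducing an odd exponent modulo n leaves it
    odd. *)
Lemma odd_fixP u : u \in V <-> u \in D /\ forall r, odd r -> power_sum r u = u.
Proof.
split=> [/twisted_fixP[Du fu]|[Du fu]]; last first.
  by apply/(twisted_fix_powerP co1); split=> // r /odd1; apply: fu.
split=> // r oddr; apply/power_sum_fixP; first exact: coprime_odd_card.
move=> a; rewrite -(expg_mod r (_ : a ^+ n = 1)%g) ?expg_cardG ?inE//.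
apply: fu; rewrite mem_odds ltn_mod (ltnW Gn1) andbT.
by rewrite odd_mod// (negPf even_card).
Qed.

Lemma card_group_neq0 : n%:R != 0 :> K.
Proof.
have [k ->] := p_natP G2; rewrite natrX expf_neq0//; exact: td_two tw.
Qed.

(** With n terms whatever the order of h, dividing by n always gives an idempotent, possibly 0. *)
Definition cyclic_sum h : KG := \sum_(j < n) E (h ^+ j).

Lemma cyclic_sumX r h : odd r -> cyclic_sum (h ^+ r) = cyclic_sum h.
Proof.
move=> oddr; have n_gt0 := ltnW Gn1.
pose f (j : 'I_n) : 'I_n := Ordinal (ltn_pmod (r * j) n_gt0).
have f_inj : injective f.
  move=> i j [] /eqP; wlog leij : i j / (j <= i)%N.
    by move=> IH; case/orP: (leq_total j i) => [/IH//|/IH hij];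
      rewrite eq_sym => /hij.
  rewrite eqn_mod_dvd ?leq_mul2l ?leij ?orbT// -mulnBr Gauss_dvdr
    ?coprime_odd_card//.
  move=> dv; apply/val_inj/eqP; rewrite eqn_leq leij andbT -subn_eq0.
  by rewrite -(modn_small (_ : i - j < n)%N) ?(leq_ltn_trans (leq_subr _ _))//
    -/(dvdn _ _).
rewrite /cyclic_sum [RHS](reindex_inj f_inj); apply: eq_bigr => j _.
by rewrite /= -expgM expg_mod// expg_cardG ?inE.
Qed.

Lemma cyclic_sum_shift h : cyclic_sum h * E h = cyclic_sum h.
Proof.
have [m nE] : {m | n = m.+1} by exists n.-1; rewrite prednK// ltnW.
have hn : (h ^+ m.+1 = 1)%g by rewrite -nE expg_cardG ?inE.
rewrite /cyclic_sum nE mulr_suml big_ord_recr /= [RHS]big_ord_recl /=.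
rewrite (twist_mul tw) -expgSr hn addrC; congr (_ + _).
by apply: eq_bigr => j _; rewrite (twist_mul tw) -expgSr.
Qed.

Lemma cyclic_sum_square h : cyclic_sum h * cyclic_sum h = n%:R *: cyclic_sum h.
Proof.
rewrite {2}/cyclic_sum mulr_sumr scaler_nat.
rewrite (eq_bigr (fun=> cyclic_sum h)) ?sumr_const ?card_ord// => j _.
elim: (nat_of_ord j) => [|i IHi].
  rewrite expg0 /cyclic_sum mulr_suml; apply: eq_bigr => i _.
  by rewrite (twist_mul tw) mulg1.
by rewrite expgSr -(twist_mul tw) mulrA IHi cyclic_sum_shift.
Qed.

Lemma cyclic_sum_fix h : h \in H -> cyclic_sum h \in V.
Proof.
move=> Hh; apply/odd_fixP; split.
  by apply: rpred_sum => j _; rewrite (twist_in tw)// groupX.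
move=> r oddr; rewrite -[RHS](cyclic_sumX h oddr) linear_sum;
  apply: eq_bigr => j _.
by rewrite /= (power_sum_twist tw)// -!expgM mulnC.
Qed.

Lemma cyclic_sum_scalar e h : primitive_idempotent V e -> h \in H ->
  cyclic_sum h * e \in <[e]>%VS.
Proof.
move=> pe Hh; have n0 := card_group_neq0.
pose a := n%:R^-1 *: cyclic_sum h.
have Va : a \in V by rewrite rpredZ ?cyclic_sum_fix.
have aa : a * a = a.
  by rewrite -scalerAl -scalerAr cyclic_sum_square [in X in _ *: X]scalerA
    mulVf// scale1r.
have -> : cyclic_sum h = n%:R *: a by rewrite scalerA mulfV// scale1r.
by rewrite -scalerAl memvZ//; case: (prim_min pe Va aa) => ->;
  rewrite ?mem0v ?memv_line.
Qed.

Lemma sum_even m (F : nat -> KG) :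
  \sum_(j < m.*2 | ~~ odd j) F j = \sum_(j < m) F j.*2.
Proof.
rewrite big_mkcond; elim: m => [|m IHm]; first by rewrite !big_ord0.
by rewrite doubleS !big_ord_recr /= IHm /= odd_double /= addr0.
Qed.

(** The sum over odd j is the full cyclic sum of h minus its even part, and the even part is half
    the cyclic sum of h^2, whose n terms run through the even powers twice. *)
Lemma sum_odd_twist_scalar e h : primitive_idempotent V e -> h \in H ->
  (\sum_(j < n | odd j) E (h ^+ j)) * e \in <[e]>%VS.
Proof.
move=> pe Hh; have nE : n = (n./2).*2.
  by rewrite -[LHS]odd_double_half (negPf even_card).
have two_even : 2%:R *: (\sum_(j < n | ~~ odd j) E (h ^+ j)) = cyclic_sum (h ^+
  2).
  rewrite /cyclic_sum [in LHS]nE (sum_even _ (fun j =>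
    E (h ^+ j)%g)) [in RHS]nE -addnn big_split_ord /=.
  rewrite scaler_nat mulr2n; congr (_ + _); apply: eq_bigr => j _.
    by rewrite -expgM mul2n.
  by rewrite expgD -!expgM !mul2n -nE expg_cardG ?inE// mul1g.
have -> : \sum_(j < n | odd j) E (h ^+ j) =
    cyclic_sum h - 2%:R^-1 *: cyclic_sum (h ^+ 2).
  rewrite -two_even scalerA mulVf ?(td_two tw)// scale1r.
  by rewrite /cyclic_sum [X in X - _](bigID (fun j : 'I_n => odd j)) /= addrK.
by rewrite mulrBl -scalerAl rpredB ?memvZ// cyclic_sum_scalar// groupX.
Qed.

(** Averaging v over the n/2 odd power maps, all of which fix it, writes v through sums of E (h^j)
    over odd j, and these act on e as scalars. *)
Lemma odd_fix_scalar e v : primitive_idempotent V e -> v \in V ->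
  v * e \in <[e]>%VS.
Proof.
move=> pe /odd_fixP[Dv fv].
have nE : n = (n./2).*2 by rewrite -[LHS]odd_double_half (negPf even_card).
have c0 : (n./2)%:R != 0 :> K.
  by have := card_group_neq0; rewrite {1}nE -mul2n natrM mulf_eq0 negb_or =>
    /andP[].
have cv : (n./2)%:R *: v = \sum_(h in H) v h *: \sum_(j < n | odd j) E (h ^+ j).
  transitivity (\sum_(j < n | odd j) v).
    have even_v : \sum_(j < n | ~~ odd j) v = v *+ n./2.
      by rewrite [in LHS]nE (sum_even _ (fun=> v)) sumr_const card_ord.
    have : \sum_(j < n) v = \sum_(j < n | odd j) v + v *+ n./2.
      by rewrite (bigID (fun j : 'I_n => odd j)) /= even_v.
    rewrite sumr_const card_ord {1}nE -addnn mulrnDr scaler_nat.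
    exact: addIr.
  under [RHS]eq_bigr do rewrite scaler_sumr.
  rewrite exchange_big; apply: eq_bigr => j oddj.
  rewrite -{1}(fv j oddj) (power_sum_twisted tw)// [LHS](bigID (mem H)) /=.
  by rewrite [X in _ + X]big1 ?addr0// => h nHh;
    rewrite (twisted_supp Dv)// scale0r.
rewrite -[v](scalerK c0) cv -scalerAl memvZ// mulr_suml.
by apply: rpred_sum => h Hh; rewrite -scalerAl memvZ// sum_odd_twist_scalar.
Qed.

End OddPowerFixed.

Section CyclotomicField.

Variables (K : fieldType) (gT : finGroupType) (H : {group gT}) (s : gT) (l : K).
Local Notation KG := (group_algebra K gT).
Local Notation D := (twisted H s l).
Local Notation E := (twist s l).
Local Notation n := #|[set: gT]|.
Local Notation V := (twisted_fix H s l (odds n)).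
Implicit Types (u v : KG) (g h : gT) (p : {poly K}).

Hypothesis tw : twist_data H s l.
Hypothesis G2 : (2.-group [set: gT])%g.
Hypothesis Gn1 : (1 < n)%N.
Hypothesis irrK : forall j, irreducible_poly ('X^(2 ^ j) + 1 : {poly K}).

Variable e : KG.
Hypothesis pe : primitive_idempotent V e.

Let De : e \in D := twisted_fix_sub (prim_mem pe).
Let ee : e * e = e := prim_idem pe.

Let E1e : E 1%g * e = e.
Proof. by rewrite (twisted_comm tw) ?(twisted_mulr1 tw)// (twist1_in tw). Qed.

Let EM g h : E (g * h) * e = E g * (E h * e).
Proof. by rewrite -(twist_mul tw) mulrA. Qed.

Lemma twistX_idem g j : E g ^+ j * e = E (g ^+ j) * e.
Proof.
case: j => [|j]; first by rewrite expr0 mul1r E1e.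
by rewrite (twistX tw).
Qed.

(** The element (e + E h e)/2 is an idempotent. It lies in V because E (h^r) e = E h e for odd r, so
    primitivity of e forces it to be 0 or e. *)
Lemma twist_involution h : h \in H -> E (h ^+ 2) * e = e ->
  E h * e = e \/ E h * e = - e.
Proof.
move=> Hh h2; have two := td_two tw.
have Eh := twist_in tw Hh.
pose f := 2%:R^-1 *: (e + E h * e).
have odd_he r : odd r -> E (h ^+ r) * e = E h * e.
  move=> oddr; rewrite -(odd_double_half r) oddr expgS EM -mul2n expgM.
  congr (_ * _); elim: r./2 => [|j IHj]; first by rewrite expg0.
  by rewrite expgSr EM h2.
have hhe : E h * e * (E h * e) = e.
  by rewrite -mulrA (mulrA e) (twisted_comm tw De Eh) -mulrA ee -EM; apply: h2.
have heR : E h * e * e = E h * e by rewrite -mulrA ee.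
have heL : e * (E h * e) = E h * e by rewrite mulrA (twisted_comm tw De Eh) heR.
have ff : f * f = f.
  rewrite /f -scalerAl -scalerAr mulrDl !mulrDr ee hhe heR heL.
  rewrite [X in _ + X]addrC -mulr2n -[(_ + _) *+ 2]scaler_nat [X in _ *:
    X]scalerA.
  by rewrite mulVf// scale1r.
have Vf : f \in V.
  have /(odd_fixP H s l G2 Gn1)[_ fe] := prim_mem pe.
  apply/(odd_fixP H s l G2 Gn1); split.
    by rewrite rpredZ// rpredD// (twisted_mul tw).
  move=> r oddr; rewrite linearZ linearD /= fe// (power_sumM tw oddr)//.
  by rewrite (power_sum_twist tw)// fe// odd_he.
have f2 : f *+ 2 = e + E h * e by rewrite -scaler_nat scalerA mulfV// scale1r.
have fe : f * e = f by rewrite -scalerAl mulrDl ee heR.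
case: (prim_min pe Vf ff); rewrite fe => f0; move: f2; rewrite f0.
  by rewrite mul0rn => /esym/eqP; rewrite addrC addr_eq0 => /eqP; right.
by rewrite mulr2n => /addrI; left.
Qed.

(* By [twist_involution] the 2-group {E h * e} has at most one involution, so it
   is generated by any element g of maximal order. *)
Lemma twist_cyclic :
  exists2 g, g \in H & (forall h, h \in H -> exists j, E h * e = E (g ^+ j) * e)
    /\ ((E g * e = e) \/ exists j, E (g ^+ (2 ^ j)) * e = - e).
Proof.
pose P k := [forall (h | h \in H), E (h ^+ (2 ^ k)) * e == e].
have exP : exists k, P k.
  have [k nE] := p_natP G2; exists k; apply/forall_inP=> h Hh.
  by rewrite -nE expg_cardG ?inE// E1e.
case: (ex_minnP exP) => -[|k] /forall_inP Pk mink.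
  exists 1%g; rewrite ?group1//; split; last by left.
  by move=> h /Pk/eqP; rewrite expg1 => ->; exists 0%N; rewrite expg0 E1e.
have [g Hg gk] : exists2 g, g \in H & E (g ^+ (2 ^ k)) * e != e.
  apply/exists_inP; apply: contraT; rewrite negb_exists_in => /forall_inP nk.
  have /mink : P k by apply/forall_inP=> h /nk; rewrite negbK.
  by rewrite ltnn.
have gN : E (g ^+ (2 ^ k)) * e = - e.
  have gk2 : E ((g ^+ (2 ^ k)) ^+ 2) * e = e.
    by rewrite -expgM mulnC -expnS; apply/eqP/Pk.
  have [eg|//] := twist_involution (groupX _ Hg) gk2.
  by rewrite eg eqxx in gk.
exists g => //; split; last by right; exists k.
suff main m : (m <= k.+1)%N -> forall h, h \in H -> E (h ^+ (2 ^ m)) * e = e ->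
    exists i, E h * e = E (g ^+ (i * 2 ^ (k.+1 - m))) * e.
  move=> h Hh; have [|i hi] := main _ (leqnn _) h Hh; first exact/eqP/Pk.
  by exists (i * 2 ^ (k.+1 - k.+1))%N.
elim: m => [|m IHm] ltmk h Hh hm.
  by exists 0%N; rewrite mul0n expg0 E1e -[RHS]hm expg1.
have [||i] := IHm (ltnW ltmk) (h ^+ 2)%g; rewrite ?groupX//.
  by rewrite -expgM -expnS.
have -> : (k.+1 - m = (k - m).+1)%N by rewrite subSn.
rewrite subSS expnS mulnCA mulnC expgM; set c := (i * _)%N => h2.
have Hg' : (g ^+ c)%g \in H by rewrite groupX.
(* On e, h^2 acts as (g^c)^2, so h g^-c acts as an involution or trivially, that is, as -1 or 1; in
   the case of -1 the exponent c is corrected by 2^k, as g^(2^k) acts as -1. *)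
have inv : E ((h * (g ^+ c)^-1) ^+ 2) * e = e.
  rewrite (twist_expMn tw) ?groupV// (twist_swap tw) ?groupX ?groupV//.
  by rewrite EM h2 -EM expVgn mulVg E1e.
have hE : E h * e = E (g ^+ c) * (E (h * (g ^+ c)^-1) * e).
  by rewrite -EM (twist_swap tw) ?groupM ?groupV// mulgKV.
have [hc|hc] := twist_involution (groupM Hh (groupVr Hg')) inv.
  by exists i; rewrite hE hc.
exists (i + 2 ^ m)%N; rewrite hE hc -gN -EM -expgD mulnDl -expnD.
by rewrite subnKC// -ltnS.
Qed.

(** By [twist_cyclic], D e consists of polynomials in E g times e, and E g satisfies on e an
    irreducible equation: X - 1 = 0 or X^(2^j) + 1 = 0. The inverse is then a Bezout coefficient. *)
Lemma odd_fix_inverse u : u \in D -> u * e != 0 ->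
  exists2 w, w \in D & u * w * e = e.
Proof.
move=> Du ue0; have [g Hg [genH gN]] := twist_cyclic.
have Eg := twist_in tw Hg.
have hornerD p : horner_alg (E g) p * e \in D.
  elim/poly_ind: p => [|p c IHp]; first by rewrite rmorph0 mul0r mem0v.
  rewrite rmorphD rmorphM /= horner_algX horner_algC mulrDl mulr_algl -mulrA.
  by rewrite (twisted_comm tw Eg De) mulrA rpredD ?rpredZ// (twisted_mul tw).
have [p up] : exists p, u * e = horner_alg (E g) p * e.
  have /fin_all_exists[j jP] : forall h, exists j, h \in H ->
    E h * e = E (g ^+ j) * e.
    move=> h; case: (boolP (h \in H)) => [/genH[j ->]|_]; first by exists j.
    by exists 0%N.
  exists (\sum_(h in H) u h *: 'X^(j h)).
  rewrite {1}(twisted_decompH tw Du) rmorph_sum !mulr_suml;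
    apply: eq_bigr => h Hh.
  rewrite -mul_polyC rmorphM rmorphXn /= horner_algX horner_algC mulr_algl.
  by rewrite -!scalerAl jP// twistX_idem.
have [phi irr_phi phi0] : exists2 phi : {poly K},
    irreducible_poly phi & horner_alg (E g) phi * e = 0.
  case: gN => [g1|[j gj]].
    exists ('X - 1%:P).
      exact: irredp_XsubC.
    rewrite rmorphB /= horner_algX horner_algC scale1r mulrBl mul1r g1 subrr//.
  exists ('X^(2 ^ j) + 1) => //.
  by rewrite rmorphD rmorphXn rmorph1 /= horner_algX mulrDl mul1r twistX_idem gj
    addNr.
have ndvd : ~~ (phi %| p).
  apply: contra ue0 => /dvdpP[c pE].
  by rewrite up pE rmorphM -mulrA phi0 mulr0.
have : coprimep phi p by rewrite irreducible_poly_coprime.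
case/Bezout_eq1_coprimepP=> -[a b] /= ab1.
exists (horner_alg (E g) b * e) => //.
have Dw := hornerD b.
have ->: u * (horner_alg (E g) b * e) * e = horner_alg (E g) b * (u * e).
  by rewrite (twisted_comm tw Du Dw) -!mulrA (mulrA e) (twisted_comm tw De Du)
    -(mulrA u) ee.
have := congr1 (fun p => horner_alg (E g) p * e) ab1.
by rewrite up rmorph1 mul1r rmorphD !rmorphM /= mulrDl -!mulrA phi0 mulr0 add0r.
Qed.

End CyclotomicField.

(** * Fields and quaternion algebras *)

Section Components.

Variables (K : fieldType) (gT : finGroupType) (H : {group gT}) (s : gT) (l : K).
Local Notation KG := (group_algebra K gT).
Local Notation D := (twisted H s l).
Local Notation E := (twist s l).
Local Notation n := #|[set: gT]|.
Implicit Types (u v w : KG) (g h a : gT).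

Hypothesis tw : twist_data H s l.

Lemma twisted_E1l : {in D, forall u, E 1%g * u = u}.
Proof. by move=> u Du; rewrite -(twist1_central tw) (twisted_mulr1 tw). Qed.

Lemma twisted_twist_central u : u \in D ->
  (forall g, E g * u = u * E g) -> forall v, v * u = u * v.
Proof.
move=> Du cu; apply: ga_central => g.
rewrite -{1}(twisted_E1l Du) mulrA (twist_delta tw) cu -(twist_delta tw).
by rewrite (twist1_central tw) mulrA (twisted_mulr1 tw).
Qed.

Lemma primitive_central P e : primitive_idempotent (twisted_fix H s l P) e ->
  (forall g, E g * e = e * E g) -> central_idempotent e.
Proof.
case=> /twisted_fix_sub De ee e0 _ cE; split=> //.
exact: twisted_twist_central.
Qed.

End Components.

Section CommutativeComponent.

Variables (K : fieldType) (gT : finGroupType) (s : gT) (l : K) (P : seq nat).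
Local Notation G := [set: gT]%G.
Local Notation D := (twisted G s l).
Local Notation E := (twist s l).
Variable e : group_algebra K gT.

Hypothesis tw : twist_data G s l.
Hypothesis pe : primitive_idempotent (twisted_fix G s l P) e.
Hypothesis inv_e : forall u, u \in D -> u * e != 0 ->
  exists2 w, w \in D & u * w * e = e.

Let De : e \in D := twisted_fix_sub (prim_mem pe).

Lemma central_idempotent_setT : central_idempotent e.
Proof.
by apply: (primitive_central tw pe) => g; apply: (twisted_comm tw);
  rewrite ?(twist_in tw) ?inE.
Qed.

Lemma field_component : field_algebra (principal_ideal e).
Proof.
have ce := central_idempotent_setT.
have subD u : u \in principal_ideal e -> u \in D.
  rewrite memv_principal// => /eqP <-; rewrite -(twisted_E1l tw De) mulrA.
  apply: (twisted_mul tw) => //; rewrite (ga_decomp u) mulr_suml;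
    apply: rpred_sum => g _.
  by rewrite -scalerAl (twist_delta tw) rpredZ// (twist_in tw) ?inE.
split=> [u v /subD Du /subD|u Bu u0]; first exact: twisted_comm.
have ue : u * e = u by apply/eqP; rewrite -memv_principal.
have [|w Dw uwe] := inv_e (subD u Bu); first by rewrite ue.
exists (w * e); first by rewrite memv_principal// -mulrA (cidem_idem ce).
by rewrite algid_principal// mulrA.
Qed.

End CommutativeComponent.

(** * The components on which s acts as -1 *)

Section QuaternionComponent.

Variables (K : fieldType) (gT : finGroupType) (Z : {group gT}) (s : gT) (P : seq
  nat).
Local Notation KG := (group_algebra K gT).
Local Notation D := (twisted Z s (-1)%R).
Local Notation E := (twist s (-1)%R).
Local Notation n := #|[set: gT]|.
Variable e : KG.
Implicit Types (u v w : KG) (g h a : gT).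

Hypothesis tw : twist_data Z s (-1 : K).
Hypothesis pe : primitive_idempotent (twisted_fix Z s (-1 : K) P) e.
Hypothesis inv_e : forall u, u \in D -> u * e != 0 ->
  exists2 w, w \in D & u * w * e = e.
Hypothesis n0 : n%:R != 0 :> K.
Hypothesis cZ : {in Z, forall z g, commute z g}.
Hypothesis ncZ : forall a, a \notin Z -> exists h, (a ^ h = s * a)%g.
Variable t : 'I_4 -> gT.
Hypothesis t_cover : forall a, exists i, (a * (t i)^-1)%g \in Z.
Hypothesis t_inj : forall a i j, (a * (t i)^-1)%g \in Z ->
  (a * (t j)^-1)%g \in Z -> i = j.

Let De : e \in D := twisted_fix_sub (prim_mem pe).
Let ee : e * e = e := prim_idem pe.
Local Notation B := (principal_ideal e).

Lemma twisted_central_center u v : u \in D -> v * u = u * v.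
Proof.
move=> Du; apply: (twisted_twist_central tw Du) => g.
rewrite [in LHS](twisted_decompH tw Du) [in RHS](twisted_decompH tw Du)
  mulr_suml mulr_sumr.
apply: eq_bigr => h Hh; rewrite -scalerAl -scalerAr !(twist_mul tw).
by rewrite (cZ Hh).
Qed.

Let ce : central_idempotent e.
Proof. by apply: (primitive_central tw pe) => g;
  apply: twisted_central_center. Qed.

Let Be u : u \in B -> u * e = u.
Proof. by rewrite memv_principal// => /eqP. Qed.

Let BeM u : u * e \in B.
Proof. by rewrite memv_principal// -mulrA ee. Qed.

Lemma component_sign u a : u \in B -> u (s * a)%g = - u a.
Proof.
move=> Bu; have sV : (s^-1 = s)%g.
  by apply/eqP; rewrite eq_sym eq_mulgV1 invgK (td_square tw).
rewrite -{1}sV -delta_mull -{1}(Be Bu) (cidem_central ce) -(twisted_E1l tw De).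
have := twist_s tw 1; rewrite mulg1 scaleN1r => Es.
rewrite !mulrA (twist_delta tw) Es !mulNr.
by rewrite (twisted_E1l tw De) -(cidem_central ce) (Be Bu) ffunE.
Qed.

Definition restrict u : KG := [ffun a => if a \in Z then u a else 0].

Lemma restrict_in u : u \in B -> restrict u \in D.
Proof.
move=> Bu; apply/twistedP=> a; rewrite !ffunE; case: ifP => // Za.
rewrite groupM ?(td_mem tw)// component_sign//.
by rewrite mulN1r opprK.
Qed.

(* Off the centre, a and s a are conjugate and u takes opposite values there. *)
Lemma conjugation_sum u : u \in B ->
  \sum_g delta K g * u * delta K g^-1 = n%:R *: restrict u.
Proof.
move=> Bu; apply/ffunP=> a; rewrite ga_sum.
have termE g : (delta K g * u * delta K g^-1) a = u (a ^ g)%g.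
  by rewrite delta_mulr delta_mull invgK.
under eq_bigr do rewrite termE.
rewrite ga_scaleE ffunE; case: ifPn => [Za|/ncZ[h ah]].
  rewrite (eq_bigr (fun=> u a)) ?sumr_const ?cardsT; last first.
    by move=> g _; rewrite conjgE (cZ Za) mulKg.
  by rewrite mulr_natl.
rewrite mulr0; set S := \sum_g _.
have : S = - S.
  rewrite {1}/S (reindex_inj (mulgI h)) /= -sumrN; apply: eq_bigr => g _.
  by rewrite conjgM ah conjMg conjgE (td_central tw) mulKg component_sign.
move/eqP; rewrite -addr_eq0 -mulr2n -mulr_natr mulf_eq0.
by rewrite (negPf (td_two tw)) orbF => /eqP.
Qed.

(** By [conjugation_sum] the restriction is a mean of conjugates of u. As V is an ideal of B only,
    the group elements are first multiplied by e. *)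
Lemma restrict_ideal (V : {vspace KG}) u : two_sided_ideal B V -> u \in V ->
  restrict u \in V.
Proof.
case/two_sided_idealP=> sVB Vl Vr Vu; have Bu := subvP sVB _ Vu.
rewrite -[restrict u](scalerK n0) -conjugation_sum// memvZ//.
apply: rpred_sum => g _; have eu : e * u = u by rewrite -(cidem_central ce) Be.
suff -> : delta K g * u * delta K g^-1 = delta K g * e * u * (delta K g^-1 * e).
  by rewrite Vr// Vl.
by rewrite (cidem_central ce (delta K g^-1)) mulrA -(mulrA _ u e) (Be Bu)
  -(mulrA _ e) eu.
Qed.

Lemma quaternion_simple : simple_algebra B.
Proof.
move=> V idV; have [->|nzV] := eqVneq V 0%VS; [by left | right].
have /two_sided_idealP[sVB Vl Vr] := idV.
have Vu := memv_pick V; set u := vpick V in Vu.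
have Bu := subvP sVB _ Vu.
have [a ua] : exists a, u a != 0.
  apply/existsP; apply: contraT => /existsPn u0; case/eqP: nzV.
  apply/eqP; rewrite -vpick0 -/u; apply/eqP/ffunP=> a; rewrite [RHS]ffunE.
  exact/eqP/negbNE/u0.
(* Translation brings the nonzero coefficient to the identity, which is central, so that the
   restriction is a nonzero element of the field D e. *)
have Vv : u * delta K a^-1 \in V.
  by rewrite -(Be Bu) -mulrA -(cidem_central ce) Vr.
have Vr1 := restrict_ideal idV Vv; set r := restrict _ in Vr1.
have r0 : r != 0.
  apply: contra_neq ua => /(congr1 (fun f : KG => f 1%g)).
  by rewrite /r ffunE group1 delta_mulr mul1g invgK ffunE.
have Dr : r \in D by rewrite restrict_in// (subvP sVB).
have [|w Dw rwe] := inv_e Dr; first by rewrite Be// (subvP sVB).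
have Ve : e \in V by rewrite -rwe -mulrA Vr.
apply/eqP; rewrite eqEsubv sVB; apply/subvP=> v Bv.
by rewrite -(Be Bv) Vl.
Qed.

(** An element of B that commutes with B equals all its conjugates, hence equals its own restriction
    to Z. *)
Lemma center_component u : (u \in 'Z(B))%VS = (u \in D) && (u \in B).
Proof.
rewrite memv_cap andbC; apply: andb_id2r => Bu.
apply/centvP/idP => [cu|Du v _]; last by rewrite (twisted_central_center v Du).
have -> : u = restrict u; last exact: restrict_in.
apply: (scalerI n0); rewrite -conjugation_sum// scaler_nat -sumr_const.
rewrite big_mkcond; apply: eq_bigr => g _; rewrite inE.
have -> : delta K g * u = u * delta K g.
  have eu : e * u = u by rewrite -(cidem_central ce) Be.
  by rewrite -{1}eu mulrA -(cu _ (BeM _)) (cidem_central ce) mulrA Be.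
by rewrite -mulrA delta_mul mulgV delta1 mulr1.
Qed.

(** B is the direct sum of the translates of F by the four representatives of G modulo Z: the
    translates have the dimension of F, and their supports lie in distinct cosets. *)
Lemma dim_component : \dim_('Z(B)) B = 4.
Proof.
set F := ('Z(B))%VS.
have memF u : (u \in F) = (u \in D) && (u \in B) := center_component u.
have Bmul g u : u \in B -> u * delta K g \in B.
  by move=> Bu; rewrite -(Be Bu) -mulrA -(cidem_central ce) mulrA BeM.
pose W (i : 'I_4) := (amulr (delta K (t i)) @: F)%VS.
have Wa i u a : u \in W i -> u a != 0 -> (a * (t i)^-1)%g \in Z.
  move=> /memv_imgP[v]; rewrite memF => /andP[Dv _] ->;
    rewrite lfunE /= delta_mulr.
  by apply: contra_neqT => nZ; rewrite (twisted_supp Dv).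
have dW i : \dim (W i) = \dim F.
  rewrite limg_dim_eq //; apply/eqP; rewrite -subv0; apply/subvP=> v.
  move=> /memv_capP[_]; rewrite memv_ker lfunE /= => /eqP v0.
  by rewrite memv0 -[v]mulr1 -(@delta1 K) -(mulgV (t i)) -delta_mul mulrA v0
    mul0r.
have dir : directv (\sum_i W i).
  apply/directv_sum_independent => u Wu su0 i _; apply/ffunP=> a;
    rewrite [RHS]ffunE.
  apply/eqP/negbNE/negP => uia; have Zi := Wa _ _ _ (Wu i isT) uia.
  have := congr1 (fun f : KG => f a) su0; rewrite /= ga_sum (bigD1 i)//= big1
    ?addr0.
    by rewrite ffunE => ui0; rewrite ui0 eqxx in uia.
  move=> j nji; apply/eqP/negbNE/negP => uja; case/eqP: nji.
  exact: t_inj (Wa _ _ _ (Wu j isT) uja) Zi.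
have sumW : (\sum_i W i)%VS = B.
  apply/eqP; rewrite eqEsubv; apply/andP; split.
    apply/subv_sumP=> i _; apply/subvP=> _ /memv_imgP[v + ->].
    by rewrite memF lfunE /= => /andP[_ Bv]; apply: Bmul.
  apply/subvP=> u Bu.
  have -> : u = \sum_i restrict (u * delta K (t i)^-1) * delta K (t i).
    apply/ffunP=> a; rewrite ga_sum; have [i Zi] := t_cover a.
    rewrite (bigD1 i)//= delta_mulr ffunE Zi delta_mulr invgK mulgKV.
    rewrite big1 ?addr0// => j nji; rewrite delta_mulr ffunE;
      case: ifP => // Zj.
    by case/eqP: nji; apply: t_inj Zj Zi.
  apply: memv_sumr => i _; apply/memv_imgP.
  exists (restrict (u * delta K (t i)^-1)); last by rewrite lfunE.
  have Bu' : u * delta K (t i)^-1 \in B by apply: Bmul.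
  rewrite memF restrict_in//=.
  apply: restrict_ideal Bu'; apply/two_sided_idealP.
  by split=> // v w Bv Bw; apply: memvM.
have := directvP dir; rewrite /= sumW => ->; under eq_bigr do rewrite dW.
rewrite sum_nat_const card_ord mulnK//.
rewrite lt0n dimv_eq0; apply: contraNneq (cidem_neq0 ce) => F0.
by rewrite -memv0 -F0 memF De memv_principal// ee /=.
Qed.

Lemma quaternion_component : quaternion_algebra B.
Proof. by split; [apply: quaternion_simple | apply: dim_component]. Qed.

End QuaternionComponent.

(** * Dimensions of the fixed spaces *)

Lemma dim_level_functions (K : fieldType) (gT : finGroupType) (S : {set gT})
    (T : finType) (k : gT -> T) (V : {vspace group_algebra K gT}) :
    (forall u : group_algebra K gT, u \in V <-> (forall a, a \notin S ->
      u a = 0) /\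
      {in S &, forall a b, k a = k b -> u a = u b}) ->
  \dim V = #|k @: S|.
Proof.
move=> VP; pose ind (c : T) : group_algebra K gT :=
  [ffun a => ((a \in S) && (k a == c))%:R].
have [X XE] : exists X : #|k @: S|.-tuple (group_algebra K gT),
    forall i : 'I_#|k @: S|, X`_i = ind (enum_val i).
  exists [tuple ind (enum_val i) | i < #|k @: S|] => i.
  by rewrite -tnth_nth tnth_mktuple.
have /fin_all_exists2[rep repS repk] : forall i : 'I_#|k @: S|,
    exists2 a, a \in S & k a = enum_val i.
  by move=> i; have /imsetP[a Sa ka] := enum_valP i; exists a.
have coef (c : 'I_#|k @: S| -> K) i a : a \in S -> k a = enum_val i ->
    (\sum_j c j *: X`_j) a = c i.
  move=> Sa ka; rewrite ga_sum (bigD1 i)//= big1 ?addr0 => [|j nji].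
    by rewrite XE ga_scaleE ffunE Sa ka eqxx; apply: mulr1.
  rewrite XE ga_scaleE ffunE Sa ka (inj_eq enum_val_inj).
  by rewrite eq_sym (negPf nji); apply: mulr0.
have freeX : free X.
  apply/freeP => c c0 i.
  by rewrite -(coef c i _ (repS i) (repk i)) c0 ffunE.
suff -> : V = <<X>>%VS by rewrite (eqP freeX) size_tuple.
apply/eqP; rewrite eqEsubv; apply/andP; split.
  apply/subvP=> u /VP[u0 uk].
  have -> : u = \sum_i u (rep i) *: X`_i.
    apply/ffunP=> a; have [Sa|nSa] := boolP (a \in S); last first.
      rewrite u0// ga_sum big1// => i _; rewrite XE ga_scaleE.
      by rewrite ffunE (negPf nSa); apply: mulr0.
    have kS : k a \in k @: S by apply: imset_f.
    have ka : k a = enum_val (enum_rank_in kS (k a)) by rewrite enum_rankK_in.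
    by rewrite (coef _ _ a Sa ka); apply: uk; rewrite ?repS// repk.
  apply: rpred_sum => i _; rewrite rpredZ// memv_span//; apply: mem_nth.
  by rewrite size_tuple.
apply/span_subvP => _ /tnthP[i ->]; rewrite (tnth_nth 0) XE; apply/VP;
  split=> [a nSa|a b Sa Sb kab].
  by rewrite ffunE (negPf nSa).
by rewrite !ffunE Sa Sb kab.
Qed.

Section DimensionCounts.

Variables (K : fieldType) (gT : finGroupType) (H : {group gT}) (s : gT) (P : seq
  nat).
Local Notation KG := (group_algebra K gT).
Local Notation n := #|[set: gT]|.
Implicit Types (u : KG) (a b : gT).

Hypotheses (sH : s \in H) (ss : (s * s = 1)%g).
Hypothesis coP : {in P, forall r, coprime n r}.

Lemma power_mem a r : r \in P -> (a ^+ r)%g \in H -> a \in H.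
Proof.
move=> Pr Har; rewrite -[a](@expgK _ [set: gT]%G r) ?inE ?coP//.
exact: groupX.
Qed.

(** M is the set of all exponents under which invariance follows from that under P: the odd numbers,
    or the powers of q. *)
Lemma dim_twisted_fix_plus (T : finType) (k : gT -> T) (M : nat -> Prop) :
    M 1%N -> {in P, forall r, M r} ->
    (forall r u a, M r -> u \in twisted_fix H s 1 P -> u (a ^+ r)%g = u a) ->
    {in H &, forall a b, k a = k b <->
      exists2 r, M r & b = (a ^+ r)%g \/ b = (s * a ^+ r)%g} ->
  \dim (twisted_fix H s (1 : K) P) = #|k @: H|.
Proof.
move=> M1 MP VM kP; apply: dim_level_functions => u; split=> [Vu|[u0 uk]].
  have Du := twisted_fix_sub Vu; split=> [a|a b Ha Hb /kP].
    by move: Du => /twistedP Du /negPf nHa; rewrite Du nHa.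
  move=> /(_ Ha Hb)[r Mr].
  have su c : c \in H -> u (s * c)%g = u c.
    by move=> Hc; have /twistedP/(_ c) := Du; rewrite Hc mul1r.
  by case=> ->; rewrite ?su ?groupX// VM.
apply/twisted_fixP; split=> [|r Pr a].
  apply/twistedP=> a; case: ifPn => [Ha|/u0//]; rewrite mul1r; apply: uk => //.
    by rewrite groupM.
  by apply/kP; rewrite ?groupM//; exists 1%N; rewrite // expg1; right.
have [Ha|nHa] := boolP (a \in H); last first.
  by rewrite !u0//; apply: contra nHa; apply: power_mem.
apply: uk; rewrite ?groupX//; apply/esym/kP; rewrite ?groupX//.
by exists r; [apply: MP | left].
Qed.

Hypothesis sC : forall g, commute s g.
Hypothesis two : 2%:R != 0 :> K.
Hypothesis oddP : {in P, forall r, odd r}.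

(** Translation by s commutes with the odd power maps, since s^r = s, so the fixed part of K[H], the
    left side, splits into its eigenspaces for 1 and -1. *)
Lemma dim_twisted_fix_split :
  \dim (twisted_fix H (1%g : gT) (1 : K) P) =
    (\dim (twisted_fix H s (1 : K) P) + \dim (twisted_fix H s (-1 : K) P))%N.
Proof.
set Vp := twisted_fix H s 1 P; set Vm := twisted_fix H s (-1) P.
have supp l u a : u \in twisted_fix H s l P -> a \notin H -> u a = 0.
  by move=> /twisted_fix_sub/twistedP Du /negPf nHa; rewrite Du nHa.
have suppE l u : u \in twisted_fix H s l P ->
  u \in twisted_fix H (1%g : gT) 1 P.
  move=> Vu; have /twisted_fixP[_ fu] := Vu; apply/twisted_fixP; split=> //.
  apply/twistedP=> a; rewrite mul1g mul1r; case: ifPn => // nHa.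
  exact: supp Vu nHa.
have dis : (Vp :&: Vm)%VS = 0%VS.
  apply/eqP; rewrite -subv0; apply/subvP=> u /memv_capP[Vpu Vmu].
  rewrite memv0; apply/eqP/ffunP=> a; rewrite [RHS]ffunE.
  have [Ha|nHa] := boolP (a \in H); last exact: supp Vpu nHa.
  have /twisted_fix_sub/twistedP/(_ a) := Vpu;
    have /twisted_fix_sub/twistedP/(_ a) := Vmu.
  rewrite Ha mul1r mulN1r => um up; move: um; rewrite -up => /eqP.
  rewrite -addr_eq0 -mulr2n -mulr_natr mulf_eq0.
  by rewrite (negPf two) orbF => /eqP.
rewrite -(dimv_disjoint_sum dis); congr (\dim _); apply/eqP.
rewrite eqEsubv; apply/andP; split; last first.
  by rewrite subv_add; apply/andP; split; apply/subvP=> u; apply: suppE.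
apply/subvP=> u /twisted_fixP[/twistedP Du fu].
have sr r : odd r -> (s ^+ r = s)%g.
  move=> oddr; rewrite -(odd_double_half r) oddr expgD expg1 -mul2n expgM.
  by rewrite [(s ^+ 2)%g]ss expg1n mulg1.
have [us usE] : exists us : KG, forall a, us a = u (s * a)%g.
  by exists [ffun a => u (s * a)%g] => a; rewrite ffunE.
have part (l : K) : l * l = 1 -> u + l *: us \in twisted_fix H s l P.
  move=> ll; apply/twisted_fixP; split=> [|r Pr a].
    apply/twistedP=> a; rewrite !ffunE !usE mulgA ss mul1g.
    case: ifPn => [Ha|nHa]; last first.
      rewrite (Du a) (Du (s * a)%g) groupMl// (negPf nHa) add0r.
      exact: mulr0.
    by rewrite mulrDr addrC; congr (_ + _);
      rewrite -[RHS]/(l * (l * _)) mulrA ll mul1r.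
  rewrite !ffunE !usE fu//; congr (_ + _ *: _).
  by rewrite -[RHS](fu r) // expgMn ?sr ?oddP//; apply: sC.
have -> : u = 2%:R^-1 *: (u + 1 *: us) + 2%:R^-1 *: (u + (-1) *: us).
  rewrite -scalerDr scale1r scaleN1r addrACA subrr addr0 -mulr2n -scaler_nat
    scalerA.
  by rewrite mulVf// scale1r.
by apply: memv_add; rewrite rpredZ// part// ?mulr1// mulrNN mulr1.
Qed.

End DimensionCounts.

(** n - 1 stands for the exponent -1 throughout. *)
Lemma pred_mul_pred_mod n : (0 < n)%N -> (n.-1 * n.-1 = 1 %[mod n])%N.
Proof.
case: n => // n _; apply/eqP; rewrite -(eqn_modDr n) -mulnSr.
by rewrite modnMl add1n modnn.
Qed.

Lemma pred_mul_mod n a r : (0 < n)%N -> (n %| a + r)%N ->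
  (n.-1 * a = r %[mod n])%N.
Proof.
case: n => // n _ /eqP dv; apply/eqP; rewrite -(eqn_modDr a) [(r + a)%N]addnC dv
  /=.
by rewrite -mulSnr modnMr.
Qed.

Section PowerSumExponents.

Variables (K : fieldType) (gT : finGroupType).
Implicit Types (u : group_algebra K gT).

Lemma power_sum_comp r k u : power_sum r (power_sum k u) = power_sum (k * r) u.
Proof.
rewrite {2}/power_sum linear_sum; apply: eq_bigr => g _.
by rewrite linearZ /= power_sum_delta expgM.
Qed.

Lemma power_sum_mod r k u : r = k %[mod #|[set: gT]|] ->
  power_sum r u = power_sum k u.
Proof.
move=> rk; apply: eq_bigr => g _; congr (_ *: delta _ _).
have gn : (g ^+ #|[set: gT]| = 1)%g by rewrite expg_cardG ?inE.
by rewrite -(expg_mod r gn) rk expg_mod.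
Qed.

Lemma power_sum1 u : power_sum 1 u = u.
Proof. by rewrite [RHS]ga_decomp; apply: eq_bigr => g _; rewrite expg1. Qed.

End PowerSumExponents.

(** * Doubling the fixed space of the minus part by a square root *)

Section QuadraticSplitting.

Variables (K : fieldType) (gT : finGroupType) (H : {group gT}) (s t : gT) (q :
  nat).
Local Notation KG := (group_algebra K gT).
Local Notation D := (twisted H s (-1 : K)).
Local Notation E := (twist s (-1 : K)).
Local Notation n := #|[set: gT]|.
Local Notation S := (twisted_fix H s (-1 : K) (odds n)).
Local Notation Vq := (twisted_fix H s (-1 : K) [:: q]).
Implicit Types (u v w : KG).

Hypothesis tw : twist_data H s (-1 : K).
Hypothesis G2 : (2.-group [set: gT])%g.
Hypothesis Gn1 : (1 < n)%N.
Hypothesis oddq : odd q.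
Hypothesis s1 : s != 1%g.
Hypotheses (Ht : t \in H) (t4 : (t ^+ 4 = s)%g).

Let two : 2%:R != 0 :> K := td_two tw.
Let coq : {in [:: q], forall r, coprime n r}.
Proof. by move=> r; rewrite inE => /eqP->; apply: coprime_odd_card. Qed.

Let VqP u : u \in Vq <-> u \in D /\ power_sum q u = u.
Proof.
split=> [/(twisted_fix_powerP coq)[Du fu]|[Du fu]].
  by split=> //; apply: fu; rewrite mem_head.
by apply/(twisted_fix_powerP coq); split=> // r; rewrite inE => /eqP->.
Qed.

Lemma odd_fix_sub_fix : (S <= Vq)%VS.
Proof.
apply/subvP=> u /(odd_fixP H s (-1 : K) G2 Gn1)[Du fu].
by apply/VqP; split=> //; apply: fu.
Qed.

Section Involution.

Variables (w : KG) (c : K).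
Hypotheses (Dw : w \in D) (c0 : c != 0) (ww : w * w = c *: E 1%g).
Hypothesis qw : power_sum q w = w.

Let mulww u : u \in D -> u * w * w = c *: u.
Proof. by move=> Du; rewrite -mulrA ww -scalerAr (twisted_mulr1 tw). Qed.

Let dimSw : \dim (amulr w @: S) = \dim S.
Proof.
rewrite limg_dim_eq//; apply/eqP; rewrite -subv0; apply/subvP=> u.
move=> /memv_capP[/twisted_fix_sub Du]; rewrite memv_ker lfunE /= => /eqP uw.
have := mulww Du; rewrite uw mul0r => /esym/eqP;
  rewrite scaler_eq0 (negPf c0) /=.
by rewrite memv0.
Qed.

(** Vq contains S and S w, of equal dimension because w^2 is a nonzero scalar; they meet in 0
    because the r-power map fixes S and negates S w. *)
Lemma dim_fix_ge r : odd r -> power_sum r w = - w -> (2 * \dim S <= \dim Vq)%N.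
Proof.
move=> oddr rw; have dis : (S :&: (amulr w @: S))%VS = 0%VS.
  apply/eqP; rewrite -subv0; apply/subvP=> v /memv_capP[Sv /memv_imgP[u Su vE]].
  have /(odd_fixP H s (-1 : K) G2 Gn1)[Du fu] := Su.
  have /(odd_fixP H s (-1 : K) G2 Gn1)[_ /(_ r oddr)] := Sv.
  rewrite vE lfunE /= (power_sumM tw oddr)// fu// rw mulrN => /esym/eqP.
  rewrite -addr_eq0 -mulr2n -scaler_nat scaler_eq0 (negPf two) /= => /eqP->.
  exact: mem0v.
rewrite mul2n -addnn -{2}dimSw -(dimv_disjoint_sum dis) dimvS// subv_add
  odd_fix_sub_fix.
apply/subvP=> _ /memv_imgP[u /(odd_fixP H s (-1 : K) G2 Gn1)[Du fu] ->].
rewrite lfunE /=; apply/VqP; split; first exact: (twisted_mul tw).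
by rewrite (power_sumM tw oddq)// fu// qw.
Qed.

(** Exponent -1 acts on Vq as an involution. Its fixed points lie in S because q and -1 generate the
    odd residues, and its negated points lie in S w. *)
Lemma dim_fix_le : q = 3 %[mod 8] -> power_sum n.-1 w = - w ->
  (\dim Vq <= 2 * \dim S)%N.
Proof.
move=> q3 nw; have oddn1 : odd n.-1.
  have := even_card G2 Gn1; have := ltnW Gn1; case: #|_| => //= m _.
  by rewrite negbK.
have inv2 u : power_sum n.-1 (power_sum n.-1 u) = u.
  rewrite power_sum_comp -[RHS]power_sum1; apply: power_sum_mod.
  exact: pred_mul_pred_mod (ltnW Gn1).
have qn u : power_sum q (power_sum n.-1 u) = power_sum n.-1 (power_sum q u).
  by rewrite !power_sum_comp mulnC.
have memS u : u \in D -> power_sum q u = u -> power_sum n.-1 u = u -> u \in S.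
  move=> Du qu nu; apply/(odd_fixP H s (-1 : K) G2 Gn1); split=> // r oddr.
  have iterq i : power_sum (q ^ i) u = u.
    elim: i => [|i IHi]; first by rewrite power_sum1.
    by rewrite expnSr -power_sum_comp IHi.
  have [k nk] := p_natP G2; have [i [qi|qi]] := pow3_cover k q3 oddr.
    by rewrite -[RHS](iterq i); apply: power_sum_mod; rewrite nk.
  rewrite -[RHS]nu -[in RHS](iterq i) power_sum_comp; apply: power_sum_mod.
  by rewrite [in RHS]mulnC; apply/esym/pred_mul_mod; rewrite ?(ltnW Gn1)// nk.
suff sub : (Vq <= S + (amulr w @: S))%VS.
  apply: leq_trans (dimvS sub) (leq_trans (dimv_add_leqif _ _) _).
  by rewrite dimSw addnn mul2n.
apply/subvP=> u /VqP[Du qu]; set u' := power_sum n.-1 u.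
have Du' : u' \in D by apply: (power_sum_twisted_in tw).
have qu' : power_sum q u' = u' by rewrite qn// qu.
have -> : u = 2%:R^-1 *: (u + u') + 2%:R^-1 *: (u - u').
  rewrite -scalerDr addrACA subrr addr0 -mulr2n -scaler_nat scalerA mulVf//
    scale1r//.
rewrite memv_add// rpredZ//.
  by apply: memS; rewrite ?rpredD// linearD /= ?qu ?qu' ?inv2 // addrC.
set v := u - u'; have Dv : v \in D by rewrite rpredB.
(* Both v and w change sign under the exponent -1, so v w is fixed; the factor c^-1 undoes w^2 =
   c. *)
apply/memv_imgP; exists (c^-1 *: (v * w)).
  rewrite rpredZ//; apply: memS.
  - exact: (twisted_mul tw).
  - by rewrite (power_sumM tw oddq)// qw linearB /= qu qu'.
  by rewrite (power_sumM tw oddn1)// nw linearB /= inv2 mulrN -mulNr opprB.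
by rewrite lfunE /= -scalerAl mulww// scalerK.
Qed.

End Involution.

Let t8 : (t ^+ 8 = 1)%g.
Proof. by rewrite (expgD t 4 4) t4 (td_square tw). Qed.

Let Et_mod k j : k = j %[mod 8] -> E (t ^+ k) = E (t ^+ j).
Proof. by move=> kj; rewrite -(expg_mod k t8) kj expg_mod. Qed.

Let Et_shift k : E (t ^+ (4 + k)) = - E (t ^+ k).
Proof. by rewrite expgD t4 (twist_s tw) scaleN1r. Qed.

Let Et_mul k j : E (t ^+ k) * E (t ^+ j) = E (t ^+ (k + j)).
Proof. by rewrite (twist_mul tw) expgD. Qed.

Let Et_in k : E (t ^+ k) \in D. Proof. by rewrite (twist_in tw)// groupX. Qed.

Let Et_pow r k : odd r -> power_sum r (E (t ^+ k)) = E (t ^+ (k * r)).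
Proof. by move=> oddr; rewrite (power_sum_twist tw)// expgM. Qed.

Let E0 : E 1%g = E (t ^+ 0). Proof. by rewrite expg0. Qed.

Let modq j r k : (q %% 8 = j)%N -> (j * r = k %[mod 8])%N ->
  (r * q = k %[mod 8])%N.
Proof. by move=> qj <-; rewrite mulnC -modnMml qj. Qed.

(* t E_1 is an 8th root of unity of order 8; the three elements below are the
   corresponding square roots of -1, 2 and -2. *)
Let w1 := E (t ^+ 2).
Let w2 := E (t ^+ 1) + E (t ^+ 7).
Let w3 := E (t ^+ 1) + E (t ^+ 3).

Let w1w1 : w1 * w1 = (-1) *: E 1%g.
Proof. by rewrite Et_mul scaleN1r E0 -Et_shift. Qed.

Let w2w2 : w2 * w2 = 2%:R *: E 1%g.
Proof.
rewrite mulrDl !mulrDr !Et_mul E0 (@Et_mod (1 + 7) 0)//.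
rewrite (@Et_mod (7 + 7) (4 + 2))// (Et_shift 2) [X in _ + X]addrC addrACA subrr
  add0r.
by rewrite -mulr2n scaler_nat.
Qed.

Let w3w3 : w3 * w3 = (- 2%:R) *: E 1%g.
Proof.
rewrite mulrDl !mulrDr !Et_mul E0 (Et_shift 0) (Et_shift 2).
rewrite [X in _ + X]addrC addrACA subrr add0r.
by rewrite -opprD -mulr2n scaleNr scaler_nat.
Qed.

Let w3_power7 r : r = 7 %[mod 8] -> odd r -> power_sum r w3 = - w3.
Proof.
move=> r7 oddr; have modr k j : (k * 7 = j %[mod 8])%N ->
  (k * r = j %[mod 8])%N.
  by move=> <-; rewrite -modnMmr r7 modnMmr.
rewrite linearD /= !Et_pow// (Et_mod (modr 1 (4 + 3) _))// (Et_mod (modr 3 (4 +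
  1) _))//.
by rewrite (Et_shift 3) (Et_shift 1) -opprD addrC.
Qed.

Let w3_q : q = 3 %[mod 8] -> power_sum q w3 = w3.
Proof.
move=> q3; rewrite linearD /= !Et_pow//.
by rewrite (Et_mod (modq (k := 3) q3 _))// (Et_mod (modq (k := 1) q3 _))//
  addrC.
Qed.

Let w3_in : w3 \in D. Proof. by rewrite rpredD. Qed.
Let N2_neq0 : - 2%:R != 0 :> K. Proof. by rewrite oppr_eq0. Qed.

(** The q-power map fixes the root of -1 if q is 1 or 5 modulo 8, that of -2 if q is 3, that of 2 if
    q is 7; the exponents 3, 7 and 3 respectively negate these roots. *)
Lemma dim_minus_ge : (2 * \dim S <= \dim Vq)%N.
Proof.
have case_i : (2 * q = 2 %[mod 8])%N -> (2 * \dim S <= \dim Vq)%N.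
  move=> q2; apply: (@dim_fix_ge w1 (-1) _ _ w1w1 _ 3) => //.
  - exact: Et_in.
  - by rewrite oppr_eq0 oner_eq0.
  - by rewrite /w1 Et_pow// (Et_mod q2).
  by rewrite /w1 Et_pow// (Et_shift 2).
have : odd (q %% 8) by rewrite odd_mod.
have : (q %% 8 < 8)%N by rewrite ltn_mod.
case Eq : (q %% 8)%N => [|[|[|[|[|[|[|[|]]]]]]]] //= _ _.
- by apply: case_i; apply: (modq Eq).
- apply: (@dim_fix_ge w3 (- 2%:R) _ _ w3w3 _ 7) => //; first exact: w3_q.
  exact: w3_power7.
- by apply: case_i; apply: (modq Eq).
apply: (@dim_fix_ge w2 2%:R _ _ w2w2 _ 3) => //.
- by rewrite rpredD.
- by rewrite linearD /= !Et_pow// (Et_mod (modq (k := 7) Eq _))// (Et_mod (modq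
  (k := 1) Eq _))// addrC.
rewrite linearD /= !Et_pow// (@Et_mod (7 * 3) (4 + 1))// (Et_shift 1) opprD
  addrC.
by congr (_ + _); rewrite (Et_shift 3) opprK.
Qed.

Lemma dim_minus_eq : q = 3 %[mod 8] -> \dim Vq = (2 * \dim S)%N.
Proof.
move=> q3; apply/eqP; rewrite eqn_leq dim_minus_ge andbT.
have oddn1 : odd n.-1.
  have := even_card G2 Gn1; have := ltnW Gn1; case: #|_| => //= m _.
  by rewrite negbK.
apply: (dim_fix_le w3_in N2_neq0 w3w3 (w3_q q3) q3); apply: w3_power7 => //.
(* Since t^4 = s is nontrivial, t has order 8; so 8 divides n, and n - 1 is 7 modulo 8, an exponent
   that negates [w3]. *)
have n8 : (8 %| n)%N.
  have t8n : (#[t]%g %| n)%N by apply: order_dvdG; rewrite inE.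
  apply: dvdn_trans t8n; have [j tj] := p_natP (mem_p_elt G2 (in_setT t)).
  rewrite tj; apply: (@dvdn_exp2l 2 3); rewrite ltnNge; apply: contra s1 => j2.
  by rewrite -t4 -order_dvdn tj (@dvdn_exp2l 2 j 2).
have /dvdnP[m nm] := n8; have : (0 < n)%N := ltnW Gn1.
rewrite nm; case: m {nm} => // m _; rewrite mulSn /=.
by rewrite -[in LHS]modnDmr modnMl addn0.
Qed.

End QuadraticSplitting.

(** * Rational classes *)

Lemma card_imset_eq (T S1 S2 : finType) (A : {set T}) (f : T -> S1) (g : T ->
  S2) :
  {in A &, forall a b, f a = f b <-> g a = g b} -> #|f @: A| = #|g @: A|.
Proof.
have half (U1 U2 : finType) (f1 : T -> U1) (g1 : T -> U2) :
    {in A &, forall a b, g1 a = g1 b -> f1 a = f1 b} ->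
      (#|f1 @: A| <= #|g1 @: A|)%N.
  move=> gf; have [->|[a0 Aa0]] := set_0Vmem A;
    first by rewrite !imset0 !cards0.
  pose rep c := odflt a0 [pick a in A | g1 a == c].
  suff -> : f1 @: A = (fun c => f1 (rep c)) @: (g1 @: A) by apply:
    leq_imset_card.
  rewrite -imset_comp; apply: eq_in_imset => a Aa /=; rewrite /rep.
  case: pickP => [b /andP[Ab /eqP gab]|/(_ a)]; last by rewrite Aa eqxx.
  exact: gf.
move=> fg; apply/eqP; rewrite eqn_leq !half// => a b Aa Ab.
  by case: (fg a b Aa Ab).
by case: (fg a b Aa Ab).
Qed.

Section GaloisExponents.

Variables (L : splittingFieldType rat) (zeta : L) (j : nat).
Hypothesis zetaP : (2 ^ j.+1).-primitive_root zeta.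

Lemma primitive_root_half : zeta ^+ (2 ^ j) = -1.
Proof.
have : (zeta ^+ (2 ^ j)) ^+ 2 == 1 by rewrite -exprM -expnSr prim_expr_order.
rewrite sqrf_eq1 => /orP[|/eqP//].
by rewrite -(prim_order_dvd zetaP) gtnNdvd ?expn_gt0// ltn_exp2l.
Qed.

Lemma cyclotomic_normal : normalField 1 <<1; zeta>>%AS.
Proof.
apply/(splitting_normalField (subv_adjoin _ _)).
exists ('X^(2 ^ j.+1) - 1).
  by apply/polyOver1P; exists ('X^(2 ^ j.+1) - 1);
    rewrite rmorphB /= map_polyXn rmorph1.
exists [seq zeta ^+ i | i <- index_iota 0 (2 ^ j.+1)].
  by rewrite big_map (factor_Xn_sub_1 zetaP) eqpxx.
apply/eqP; rewrite eqEsubv; apply/andP; split.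
  apply/Fadjoin_seqP; split=> [|_ /mapP[i _ ->]]; first exact: subv_adjoin.
  by rewrite rpredX// memv_adjoin.
apply/FadjoinP; split; first exact: subv_adjoin_seq.
apply: seqv_sub_adjoin; apply/mapP; exists 1%N;
  rewrite ?expr1// mem_index_iota /=.
by rewrite (@ltn_exp2l 2 0).
Qed.

(** An automorphism fixes zeta^(2^j) = -1, which excludes even r. For odd r, zeta^r is a root of
    X^(2^j) + 1, which by irreducibility is the minimal polynomial of zeta up to a scalar. *)
Lemma galois_exponentP r :
  (exists2 sigma, sigma \in 'Gal(<<1; zeta>> / 1)%g & (sigma : gal_of _) zeta =
    zeta ^+ r)
    <-> odd r.
Proof.
have half := primitive_root_half.
have halfr : (zeta ^+ r) ^+ (2 ^ j) = (-1) ^+ r by rewrite -exprM mulnC exprM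
  half.
split=> [[sigma _ sz]|oddr].
  apply: contraT => evr; move: halfr; rewrite -sz -rmorphXn half rmorphN1.
  rewrite -signr_odd (negPf evr) => /eqP; rewrite eq_sym -addr_eq0 -mulr2n.
  by rewrite -(rmorph_nat (in_alg L) 2) fmorph_eq0.
have pzeta (z : L) : root (map_poly (in_alg L) ('X^(2 ^ j) + 1)) z = (z ^+ (2 ^
  j) == -1).
  by rewrite rmorphD /= map_polyXn rmorph1 rootE !hornerE addr_eq0.
have [] := normalField_root_minPoly (b := zeta ^+ r) (subv_adjoin 1 zeta)
  cyclotomic_normal (memv_adjoin _ _).
  have /polyOver1P[m mE] := minPolyOver 1 zeta.
  have mp : m %| 'X^(2 ^ j) + 1.
    rewrite -(dvdp_map (in_alg L)) -mE; apply: minPoly_dvdp.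
      by apply/polyOver1P; exists ('X^(2 ^ j) + 1).
    by rewrite pzeta half.
  have [_ irr] := irreducible_Xpow2_add1 j.
  have szm : size m != 1.
    by rewrite -(size_map_poly (in_alg L)) -mE size_minPoly eqSS -lt0n.
  have /andP[_ Pm] := irr m szm mp; rewrite -(dvdp_map (in_alg L)) -mE in Pm.
  rewrite -dvdp_XsubCl; apply: dvdp_trans Pm.
  by rewrite dvdp_XsubCl pzeta halfr -signr_odd oddr.
by move=> sigma ? ?; exists sigma.
Qed.

End GaloisExponents.

(** * Noncentral rational classes as cyclic subgroups of G/G' *)

Section KClassCount.

Variables (gT : finGroupType) (s : gT) (N : {group gT}).
Variables (L : splittingFieldType rat) (zeta : L).
Local Notation G := [set: gT]%G.
Local Notation Z := 'Z(G)%g.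
Implicit Types (a b v w z : gT).

Hypothesis G2 : (2.-group G)%g.
Hypothesis zetaP : (exponent G).-primitive_root zeta.
Hypotheses (sZ : s \in Z) (ss : (s * s = 1)%g) (s1 : s != 1%g).
Hypotheses (NE : N = <[s]>%g :> {set gT}) (nN : (N <| G)%g).
Hypothesis commG : forall g h, [~ g, h]%g = 1%g \/ [~ g, h]%g = s.

Let sC g : commute s g.
Proof. by have /centerP[_] := sZ; apply; rewrite inE. Qed.

Let memN a : (a \in N) = (a == 1%g) || (a == s).
Proof.
rewrite NE; apply/cycleP/orP => [[k ->]|[]/eqP->]; last 2 first.
- by exists 0%N.
- by exists 1%N; rewrite expg1.
rewrite -[k]odd_double_half expgD -mul2n expgM [(s ^+ 2)%g]ss expg1n mulg1.
by case: (odd k); [right | left].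
Qed.

Let inNN a : a \in 'N(N)%g.
Proof. by rewrite (subsetP (normal_norm nN))// inE. Qed.

Lemma coset_eqP a b : coset N a = coset N b <-> b = a \/ b = (s * a)%g.
Proof.
have -> : coset N a = coset N b <-> (b * a^-1)%g \in N.
  split=> [eqab|Nab].
    by rewrite -[_ \in _]/((b * a^-1)%g \in gval N) coset_idr ?groupM ?groupV//
      morphM ?groupV// morphV//= eqab mulgV.
  by rewrite -[b](mulgKV a) morphM ?groupM ?groupV//= (coset_id Nab) mul1g.
rewrite memN; split=> [/orP[]/eqP ba|[]->].
- by left; apply/eqP; rewrite eq_mulgV1 ba.
- by right; rewrite -ba mulgKV.
- by rewrite mulgV eqxx.
by rewrite mulgK eqxx orbT.
Qed.

Lemma cycle_coset_eqP a b : <[coset N a]>%g = <[coset N b]>%g <->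
  exists2 r, odd r & b = (a ^+ r)%g \/ b = (s * a ^+ r)%g.
Proof.
have pa : (2.-elt (coset N a))%g.
  by apply: morph_p_elt; rewrite ?inNN// (mem_p_elt G2) ?inE.
split=> [/(cycle_eq_oddP _ pa)[r oddr ab]|[r oddr ab]].
  by exists r => //; apply/coset_eqP; rewrite ab morphX.
apply/(cycle_eq_oddP _ pa); exists r => //.
by rewrite -morphX//=; apply/esym/coset_eqP.
Qed.

Let s_odd r : odd r -> (s ^+ r = s)%g.
Proof.
move=> oddr; rewrite -(odd_double_half r) oddr expgD expg1 -mul2n expgM.
by rewrite [(s ^+ 2)%g]ss expg1n mulg1.
Qed.

Let sX r a : odd r -> ((s * a) ^+ r = s * a ^+ r)%g.
Proof. by move=> oddr; rewrite expgMn ?s_odd//; apply: sC. Qed.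

Lemma conjg_cases a g : (a ^ g = a \/ a ^ g = s * a)%g.
Proof.
rewrite sC; case: (commG a g) => ag; [left | right].
  by rewrite -[LHS](mulKVg a) -commgEl ag mulg1.
by rewrite -ag commgEl mulKVg.
Qed.

Lemma square_center a : (a ^+ 2)%g \in Z.
Proof.
apply/centerP; split=> [|g _]; first by rewrite inE.
apply/commgP/conjg_fixP; rewrite conjXg; case: (conjg_cases a g) => [->//|->].
by rewrite expgMn ?[(s ^+ 2)%g]ss ?mul1g//; apply: sC.
Qed.

Lemma class_noncentral w : w \notin Z -> (w ^: G)%g = [set w; s * w]%g.
Proof.
move=> nZw; apply/setP=> v; rewrite !inE; apply/imsetP/orP =>
  [[g _ ->]|[]/eqP->].
- by case: (conjg_cases w g) => ->; rewrite eqxx; [left | right].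
- by exists 1%g; rewrite ?inE ?conjg1.
have [g gw] : exists g, (w ^ g)%g != w.
  apply/existsP; apply: contraNT nZw => /existsPn fixw.
  apply/centerP; split; rewrite ?inE// => g _.
  by apply/commgP/conjg_fixP/eqP/negbNE/fixw.
by exists g; rewrite ?inE//; case: (conjg_cases w g) gw => [->|-> //];
  rewrite eqxx.
Qed.

Let exponentE : exists j, exponent G = (2 ^ j.+1)%N.
Proof.
have := G2; rewrite -pnat_exponent => /p_natP[[|j] ej]; last by exists j.
have := expg_exponent (in_setT s); rewrite ej expg1 => s0.
by case/eqP: s1.
Qed.

Let mem_galois (r : 'I_(exponent G)) : (r \in galois_exponents G zeta) = odd r.
Proof.
have [j ej] := exponentE; have zj := zetaP; rewrite ej in zj.
rewrite inE; apply/exists_inP/idP => [[sg Gs /eqP sz]|].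
  by apply/(galois_exponentP zj); exists sg.
by move/(galois_exponentP zj) => [sg Gs sz]; exists sg; rewrite ?sz.
Qed.

Let class_power w r : w \notin Z -> odd r ->
  [set (g ^+ r)%g | g in (w ^: G)%g] = [set w ^+ r; s * w ^+ r]%g.
Proof.
by move=> nZw oddr; rewrite class_noncentral// imsetU1 imset_set1 sX.
Qed.

Lemma K_classP w (C : {set gT}) : w \notin Z ->
  reflect (exists2 r, odd r & C = [set w ^+ r; s * w ^+ r]%g)
    (C \in K_class G zeta (w ^: G)%g).
Proof.
move=> nZw; apply: (iffP imsetP) => [[r + ->]|[r oddr ->]].
  by rewrite mem_galois => oddr; exists r; rewrite ?class_power.
have e_gt0 := exponent_gt0 G; exists (Ordinal (ltn_pmod r e_gt0)).
  by rewrite mem_galois /= odd_mod//; have [j ->] := exponentE; rewrite oddX.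
rewrite class_power//=; last by rewrite odd_mod//; have [j ->] := exponentE;
  rewrite oddX.
have eG : (w ^+ exponent G = 1)%g by rewrite expg_exponent ?inE.
by rewrite expg_mod.
Qed.

Let pair_eq a b : [set a; s * a]%g = [set b; s * b]%g -> b = a \/ b = (s * a)%g.
Proof.
move=> ab; have : b \in [set a; s * a]%g by rewrite ab !inE eqxx.
by rewrite !inE => /orP[]/eqP; [left | right].
Qed.

Let pair_s a : [set s * a; s * (s * a)]%g = [set a; s * a]%g.
Proof. by rewrite mulgA ss mul1g setUC. Qed.

(** The conjugacy class {w, s w} is a coset of N, and its odd powers are the generators of the
    cyclic group that this coset generates in G/N. *)
Lemma K_class_eqP w v : w \notin Z -> v \notin Z ->
  K_class G zeta (w ^: G)%g = K_class G zeta (v ^: G)%g <->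
    <[coset N w]>%g = <[coset N v]>%g.
Proof.
move=> nZw nZv; split=> [eqK|].
  have : [set v; s * v]%g \in K_class G zeta (w ^: G)%g.
    by rewrite eqK; apply/K_classP => //; exists 1%N; rewrite // expg1.
  case/K_classP=> // r oddr /esym/pair_eq wv; apply/cycle_coset_eqP.
  by exists r.
have sub a b : a \notin Z -> b \notin Z -> <[coset N a]>%g = <[coset N b]>%g ->
    K_class G zeta (b ^: G)%g \subset K_class G zeta (a ^: G)%g.
  move=> nZa nZb /cycle_coset_eqP[r oddr ab];
    apply/subsetP=> C /K_classP[//|r' oddr' ->].
  apply/K_classP => //; exists (r * r')%N; first by rewrite oddM oddr.
  by case: ab => ->; rewrite ?sX// -!expgM ?pair_s.
by move=> kwv; apply/eqP; rewrite eqEsubset !sub.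
Qed.

Lemma class_in_K_class c : (c ^: G)%g \in K_class G zeta (c ^: G)%g.
Proof.
have e_gt0 := exponent_gt0 G; apply/imsetP; exists (Ordinal (ltn_pmod 1 e_gt0)).
  by rewrite mem_galois /= odd_mod//; have [j ->] := exponentE; rewrite oddX.
rewrite -[LHS]imset_id; apply: eq_imset => g /=.
by rewrite (expg_mod 1 (_ : g ^+ exponent G = 1)%g) ?expg1// expg_exponent ?inE.
Qed.

Lemma noncentral_coset a z : a \in Z -> z \notin Z -> (a * z)%g \notin Z.
Proof. by move=> Za; rewrite groupMl. Qed.

(** Squares are central, so odd powers of an element of Z z stay in Z z; hence a Q-class with one
    member of the required form consists of such classes. *)
Lemma card_K_classes_involving z : z \notin Z ->
  #|K_classes_involving G zeta s z| =
    #|(fun w => <[coset N w]>%g) @: (Z :* z)%g|.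
Proof.
move=> nZz.
have nZ w : w \in (Z :* z)%g -> w \notin Z.
  by case/rcosetP=> a Za ->; apply: noncentral_coset.
rewrite -(card_imset_eq (f := fun w => K_class G zeta (w ^: G)%g)); last first.
  by move=> w v /nZ nZw /nZ nZv; apply: K_class_eqP.
congr #|pred_of_set _|; apply/setP=> X; rewrite inE.
apply/andP/imsetP => [[/imsetP[_ /imsetP[c _ ->] ->] sub]|[w Zzw ->]].
  exists c => //.
  have /(subsetP sub)/imsetP[a Za cE] := class_in_K_class c.
  have : c \in (c ^: G)%g by apply: class_refl.
  rewrite cE !inE => /orP[]/eqP->; apply/rcosetP; first by exists a.
  by exists (s * a)%g; rewrite ?groupM.
have nZw := nZ w Zzw; split.
  by apply: imset_f; apply: imset_f; rewrite inE.
apply/subsetP=> C /K_classP[//|r oddr ->].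
have [a Za wE] := rcosetP Zzw.
apply/imsetP; exists (w ^+ r * z^-1)%g; last by rewrite -[(s * _ * z)%g]mulgA
  mulgKV.
have -> : (w ^+ r * z^-1 = (w ^+ 2) ^+ r./2 * a)%g.
  rewrite -{1}(odd_double_half r) oddr add1n expgSr -mul2n expgM -mulgA.
  by rewrite {2}wE mulgK.
by rewrite groupM// groupX// square_center.
Qed.

End KClassCount.

(** * The decomposition of the group algebra *)

Section Assembly.

Variables (K : fieldType) (A : falgType K).

Lemma number_of_simple_components_sum a b :
  sum_of_fields_and_quaternion_algebras A a b ->
    number_of_simple_components A (a + b).
Proof.
case=> B [[sB dB iB] fB qB].
apply: (@number_of_simple_components_wedderburn _ _ _ (fun i => B (split i))).
have reV : (\sum_i B (split i) = \sum_j B j)%VS.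
  by rewrite [RHS](reindex split)//; exists unsplit => i _;
    rewrite ?splitK ?unsplitK.
split; last first.
  move=> i; case: (split i) => j; first exact: field_algebra_simple.
  by case: (qB j).
split=> //; first by rewrite reV.
apply/directv_sum_independent => u Bu su0 i _.
have /directv_sum_independent indB := dB.
rewrite -[i]splitK; apply: (indB (fun j => u (unsplit j))) => // [j _|].
  by have := Bu (unsplit j) isT; rewrite unsplitK.
have bij : bijective (@unsplit a b) by exists (@split a b);
  [apply: unsplitK | apply: splitK].
transitivity (\sum_i u i) => //.
by rewrite [RHS](reindex _ (onW_bij _ bij)).
Qed.

End Assembly.

Section GroupAlgebraDecomposition.

Variables (K : fieldType) (gT : finGroupType) (Z : {group gT}) (s : gT) (P : seq
  nat).
Local Notation G := [set: gT]%G.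
Local Notation KG := (group_algebra K gT).
Local Notation n := #|[set: gT]|.
Local Notation Vp := (twisted_fix G s (1 : K) P).
Local Notation Vm := (twisted_fix Z s (-1 : K) P).

Hypotheses (twp : twist_data G s (1 : K)) (twm : twist_data Z s (-1 : K)).
Hypothesis oddP : {in P, forall r, odd r}.
Hypothesis coP : {in P, forall r, coprime n r}.
Hypothesis n0 : n%:R != 0 :> K.
Hypothesis cZ : {in Z, forall z g, commute z g}.
Hypothesis ncZ : forall a, a \notin Z -> exists h, (a ^ h = s * a)%g.
Variable t : 'I_4 -> gT.
Hypothesis t_cover : forall a, exists i, (a * (t i)^-1)%g \in Z.
Hypothesis t_inj : forall a i j, (a * (t i)^-1)%g \in Z ->
  (a * (t j)^-1)%g \in Z -> i = j.
Hypothesis splitVp : forall e v, primitive_idempotent Vp e -> v \in Vp ->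
  v * e \in <[e]>%VS.
Hypothesis splitVm : forall e v, primitive_idempotent Vm e -> v \in Vm ->
  v * e \in <[e]>%VS.
Hypothesis inv_p : forall e u, primitive_idempotent Vp e ->
  u \in twisted G s (1 : K) ->
  u * e != 0 -> exists2 w, w \in twisted G s (1 : K) & u * w * e = e.
Hypothesis inv_m : forall e u, primitive_idempotent Vm e ->
  u \in twisted Z s (-1 : K) ->
  u * e != 0 -> exists2 w, w \in twisted Z s (-1 : K) & u * w * e = e.

Let two : 2%:R != 0 :> K := td_two twp.

Lemma twist1_sum : twist s 1 1 + twist s (-1) 1 = 1 :> KG.
Proof.
rewrite twist.unlock -scalerDr scale1r scaleN1r addrACA subrr addr0 -mulr2n.
by rewrite -scaler_nat scalerA mulVf// scale1r delta1.
Qed.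

Lemma twist1_orthogonal : twist s (1 : K) 1 * twist s (-1) 1 = 0 :> KG.
Proof.
have := congr1 (fun u => twist s (1 : K) 1 * u) twist1_sum.
rewrite mulrDr mulr1 (twist1_idem twp) -[RHS]addr0.
exact: addrI.
Qed.

Lemma decomposition_of_fixed :
  sum_of_fields_and_quaternion_algebras KG (\dim Vp) (\dim Vm).
Proof.
have [ep [pp op sp]] := split_decomposition (twisted_fix_comm twp (P := P))
  (twisted_fix_mul twp oddP coP) (twist1_fix twp oddP coP) (twist1_idem twp)
  (twisted_fix_mulr1 twp (P := P)) splitVp.
have [em [pm om sm]] := split_decomposition (twisted_fix_comm twm (P := P))
  (twisted_fix_mul twm oddP coP) (twist1_fix twm oddP coP) (twist1_idem twm)
  (twisted_fix_mulr1 twm (P := P)) splitVm.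
pose e i := match i with inl i => ep i | inr j => em j end.
have ce i : central_idempotent (e i).
  case: i => i /=; first exact: central_idempotent_setT twp (pp i).
  apply: (primitive_central twm (pm i)) => g.
  apply: (twisted_central_center twm cZ); exact: twisted_fix_sub (prim_mem (pm
    i)).
have opm i j : ep i * em j = 0.
  have Dp := twisted_fix_sub (prim_mem (pp i));
    have Dm := twisted_fix_sub (prim_mem (pm j)).
  rewrite -(twisted_mulr1 twp Dp) -(twisted_E1l twm Dm) -mulrA (mulrA (twist _ _
    _)).
  by rewrite twist1_orthogonal mul0r mulr0.
exists (fun i => principal_ideal (e i)); split.
- apply: principal_ideal_direct_sum => //.
    case=> i [] j //= nij.
    + by apply: op; apply: contra nij => /eqP->.
    + by have := cidem_central (ce (inr i)) (ep j); rewrite /= opm => <-.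
    + by apply: om; apply: contra nij => /eqP->.
  by rewrite big_sumType /= sp sm twist1_sum.
- move=> i; apply: field_component twp (pp i) _ => u; exact: inv_p (pp i).
move=> j; apply: (quaternion_component twm (pm j) _ n0 cZ ncZ t_cover t_inj).
by move=> u; apply: inv_m (pm j).
Qed.

End GroupAlgebraDecomposition.

(** * Evaluation of the dimensions for the group of type D4 *)

Section Counts.

Variables (m1 m2 : nat) (gT : finGroupType) (t1 t2 x y : gT).
Hypotheses (m1_ge3 : (3 <= m1)%N) (m2_ge3 : (3 <= m2)%N).
Hypothesis D4 : presented_D4 m1 m2 t1 t2 x y.
Local Notation G := [set: gT]%G.
Local Notation s := (t1 ^+ (2 ^ m1.-1))%g.
Local Notation Z := ('Z(G))%G.
Local Notation N := (G^`(1))%G.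
Local Notation n := #|[set: gT]|.
Local Notation kN := (fun a : gT => <[coset N a]>%g).

Let G2 : (2.-group G)%g := D4_pgroup m1_ge3 D4.
Let Gn1 : (1 < n)%N := D4_card_gt1 m1_ge3 D4.
Let ss : (s * s = 1)%g := D4_ss m1_ge3 D4.
Let s1 : s != 1%g := D4_s_neq1 m1_ge3 D4.
Let sZ : s \in Z := D4_sZ D4.
Let sC g : commute s g := D4_sC D4 g.
Let NE : N = <[s]>%g :> {set gT} := D4_derE D4.
Let nN : (N <| G)%g := der_normal 1 G.
Let commG g h : [~ g, h]%g = 1%g \/ [~ g, h]%g = s := D4_commutator m1_ge3 D4 g
  h.
Let coset_cycleP := cycle_coset_eqP G2 ss NE nN.
Let oddsP : {in odds n, forall r, odd r}.
Proof. by move=> r; rewrite mem_odds => /andP[]. Qed.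
Let odds_co : {in odds n, forall r, coprime n r}.
Proof. by move=> r /oddsP; apply: coprime_odd_card. Qed.

Lemma coset_image : coset N @: G = [set: coset_of N].
Proof.
apply/setP=> c; rewrite inE; apply/imsetP; exists (repr c); rewrite ?inE//.
by rewrite coset_reprK.
Qed.

Lemma number_of_cyclic_subgroups_coset :
  number_of_cyclic_subgroups (G / G^`(1))%g = #|kN @: G|.
Proof.
rewrite (number_of_cyclic_subgroupsE (G / N)%G) /= quotientT -coset_image
  -imset_comp.
by [].
Qed.

(** The cosets of Z by 1, x, y, xy cover G, and each is stable under odd powers and under s, so
    elements of different cosets generate different cyclic subgroups of G/G'. *)
Lemma D4_classes_count (L : splittingFieldType rat) (zeta : L) :
    (exponent G).-primitive_root zeta ->
  (#|kN @: G| = #|kN @: Z| + #|K_classes_involving G zeta s x| +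
    #|K_classes_involving G zeta s y| + #|K_classes_involving G zeta s (x *
      y)%g|)%N.
Proof.
move=> zetaP; pose t := D4_rep x y.
have t_inj := D4_rep_inj m1_ge3 D4.
have nZt i : i != ord0 -> t i \notin Z.
  move=> ni0; apply: contra ni0 => Zt; apply/eqP; apply: (t_inj (t i)).
    by rewrite mulgV group1.
  by rewrite /D4_rep tnth0 invg1 mulg1.
have cardK i : i != ord0 -> #|K_classes_involving G zeta s (t i)| = #|kN @: (Z
  :* t i)%g|.
  by move=> ni0; apply: (card_K_classes_involving G2 zetaP sZ ss s1 NE nN
    commG); apply: nZt.
have -> : kN @: G = \bigcup_i kN @: (Z :* t i)%g.
  apply/eqP; rewrite eqEsubset; apply/andP; split; last first.
    by apply/bigcupsP=> i _; apply: imsetS; apply: subsetT.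
  apply/subsetP=> _ /imsetP[a _ ->]; have [i Zi] := D4_rep_cover m1_ge3 D4 a.
  apply/bigcupP; exists i => //; apply: imset_f.
  by rewrite mem_rcoset.
rewrite -sum1_card partition_disjoint_bigcup => [|i j nij]; last first.
  rewrite -setI_eq0; apply: contraT => /set0Pn[_ /setIP[/imsetP[a Zia ->]
    /imsetP[b Zjb]]].
  move=> /coset_cycleP[r oddr ab]; case/eqP: nij.
  rewrite !mem_rcoset in Zia Zjb; apply: (t_inj b) => //.
  have bE : (b * (t i)^-1 = (b * a^-1) * (a * (t i)^-1))%g by rewrite mulgA
    mulgKV.
  rewrite bE groupM//.
  have ar : (a ^+ r * a^-1 = (a ^+ 2) ^+ r./2)%g.
    by rewrite -{1}(odd_double_half r) oddr add1n expgSr mulgK -mul2n expgM.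
  have Zar : (a ^+ r * a^-1)%g \in Z.
    by rewrite ar groupX// (square_center sZ ss commG).
  by case: ab => ->; [exact: Zar | rewrite -mulgA groupM].
rewrite !big_ord_recl big_ord0 /= addn0 !sum1_card !addnA.
rewrite -[K_classes_involving G zeta s x]/(K_classes_involving G zeta s (t (lift
  ord0 ord0))).
rewrite -[K_classes_involving G zeta s y]/(K_classes_involving G zeta s (t (lift
  ord0 (lift ord0 ord0)))).
rewrite -[K_classes_involving G zeta s (x * y)]/(K_classes_involving G zeta s (t
  (lift ord0 (lift ord0 (lift ord0 ord0))))).
by rewrite !cardK// /t /D4_rep tnth0 rcoset1.
Qed.

Section OverField.

Variable K : fieldType.
Hypothesis two : 2%:R != 0 :> K.

Lemma D4_twp : twist_data G s (1 : K).
Proof.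
split=> //; rewrite ?inE ?mulr1// => g h _ _.
by case: (commG g h) => ->; [left | right].
Qed.

Lemma D4_twm : twist_data Z s (-1 : K).
Proof.
split=> //; first by rewrite mulrNN mulr1.
move=> g h /centerP[_ cg] _; left; apply/eqP/commgP; apply: cg.
by rewrite inE.
Qed.

Lemma dim_odd_plus (H : {group gT}) : s \in H ->
  \dim (twisted_fix H s (1 : K) (odds n)) = #|kN @: H|.
Proof.
move=> sH; apply: (dim_twisted_fix_plus sH odds_co (M := fun r => odd r)) => //.
  move=> r u a oddr /(odd_fixP H s (1 : K) G2 Gn1)[_ fu].
  by have /(power_sum_fixP u (coprime_odd_card G2 oddr)) := fu r oddr; apply.
Qed.

Lemma dim_odd_minus :
  (\dim (twisted_fix Z s (-1 : K) (odds n)) + #|kN @: Z| =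
    number_of_cyclic_subgroups Z)%N.
Proof.
rewrite addnC -dim_odd_plus// -(dim_twisted_fix_split sZ ss sC two oddsP).
rewrite number_of_cyclic_subgroupsE.
apply: (dim_twisted_fix_plus (group1 Z) odds_co (M := fun r => odd r)) => //.
  move=> r u a oddr /(odd_fixP Z 1%g (1 : K) G2 Gn1)[_ fu].
  by have /(power_sum_fixP u (coprime_odd_card G2 oddr)) := fu r oddr; apply.
move=> a b _ _; split=> [/(cycle_eq_oddP _ (mem_p_elt G2 (in_setT a)))[r oddr
  ->]|[r oddr ab]].
  by exists r => //; left.
apply/(cycle_eq_oddP _ (mem_p_elt G2 (in_setT a))); exists r => //.
by case: ab => ->; rewrite ?mul1g.
Qed.

Lemma dim_odd_minus_classes (L : splittingFieldType rat) (zeta : L) :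
    (exponent G).-primitive_root zeta ->
  (\dim (twisted_fix Z s (-1 : K) (odds n)) + number_of_cyclic_subgroups (G /
    G^`(1))%g =
    number_of_cyclic_subgroups Z + #|K_classes_involving G zeta s x| +
    #|K_classes_involving G zeta s y| + #|K_classes_involving G zeta s (x *
      y)%g|)%N.
Proof.
move=> zetaP; rewrite number_of_cyclic_subgroups_coset (D4_classes_count zetaP).
by rewrite !addnA dim_odd_minus.
Qed.

Lemma dim_power_plus q : odd q ->
  \dim (twisted_fix G s (1 : K) [:: q]) = #|@power_orbit (coset_of N) q @: [set:
    coset_of N]|.
Proof.
move=> oddq; rewrite -coset_image -imset_comp.
have co1 : {in [:: q], forall r, coprime n r}.
  by move=> r; rewrite inE => /eqP->; apply: coprime_odd_card.
have Q2 : (2.-group [set: coset_of N])%g by rewrite -quotientT quotient_pgroup.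
apply: (dim_twisted_fix_plus (in_setT s : s \in G) co1 (M := fun r =>
  exists i, r = (q ^ i)%N)).
- by exists 0%N.
- by move=> r; rewrite inE => /eqP->; exists 1%N; rewrite expn1.
- move=> _ u a [i ->] /twisted_fixP[_ fu]; elim: i => [|i IHi];
  first by rewrite expg1.
  by rewrite expnSr expgM fu ?mem_head.
have inN g : g \in 'N(N)%g by rewrite (subsetP (normal_norm nN))// inE.
move=> a b _ _ /=; rewrite (power_orbitP Q2 oddq);
  split=> [[i ab]|[_ [i ->] ab]].
  exists (q ^ i)%N; first by exists i.
  by apply/(coset_eqP ss NE nN); rewrite ab morphX.
by exists i; rewrite -morphX//=; apply/esym/(coset_eqP ss NE nN).
Qed.

End OverField.

Let Q2 : (2.-group [set: coset_of N])%g.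
Proof. by rewrite -quotientT quotient_pgroup. Qed.

Let cyclesE : (fun c : coset_of N => <[c]>%g) @: [set: coset_of N] = kN @: G.
Proof. by rewrite -coset_image -imset_comp. Qed.

Let card_small : #|[set C in (fun c : coset_of N =>
  <[c]>%g) @: [set: coset_of N] | (#|C| <= 4)%N]| = 10%N.
Proof.
apply: (card_small_cycles Q2).
  have := D4_card_Ldiv m1_ge3 m2_ge3 D4 (isT : 1 <= 2)%N; rewrite quotientT.
  by [].
have := D4_card_Ldiv m1_ge3 m2_ge3 D4 (isT : 2 <= 2)%N; rewrite quotientT.
by [].
Qed.

Lemma D4_orbits_ge q : odd q ->
  (2 * #|kN @: G| - 10 <= #|@power_orbit (coset_of N) q @: [set: coset_of
    N]|)%N.
Proof. by move=> oddq; rewrite -card_small -cyclesE;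
  apply: card_power_orbits_ge. Qed.

Lemma D4_orbits_eq q : odd q -> q = 3 %[mod 8] ->
  #|@power_orbit (coset_of N) q @: [set: coset_of N]| = (2 * #|kN @: G| - 10)%N.
Proof. by move=> oddq q3; rewrite -card_small -cyclesE;
  apply: card_power_orbits_eq. Qed.

Lemma D4_ten_le : (10 <= #|kN @: G|)%N.
Proof. by rewrite -card_small -cyclesE; apply/subset_leq_card/subsetP=> C;
  rewrite inE => /andP[]. Qed.

Let Zcomm : {in Z, forall z g, commute z g}.
Proof. by move=> z /centerP[_ cz] g; apply: cz; rewrite inE. Qed.

(** Here m1 >= 3 provides a central fourth root of s, hence a primitive 8th root of unity in the
    minus part. *)
Lemma D4_root4 : exists2 t, t \in Z & (t ^+ 4 = s)%g.
Proof.
exists (t1 ^+ (2 ^ (m1 - 3)))%g; first exact: groupX (D4_t1Z D4).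
rewrite -expgM; congr (_ ^+ _)%g; rewrite (_ : 4 = 2 ^ 2)%N// -expnD.
congr (_ ^ _)%N; case: m1 m1_ge3 => [|[|[|m]]] //= _.
by rewrite !subSS subn0 addn2.
Qed.

Lemma D4_rational_decomposition (K : fieldType) :
    2%:R != 0 :> K -> (forall j, irreducible_poly ('X^(2 ^ j) + 1 : {poly K}))
      ->
  sum_of_fields_and_quaternion_algebras (group_algebra K gT)
    (\dim (twisted_fix G s (1 : K) (odds n))) (\dim (twisted_fix Z s (-1 : K)
      (odds n))).
Proof.
move=> two irrK; have twp := D4_twp two; have twm := D4_twm two.
apply: (decomposition_of_fixed twp twm oddsP odds_co (card_group_neq0 twp G2)
  Zcomm
  (D4_conj_s m1_ge3 D4) (D4_rep_cover m1_ge3 D4) (D4_rep_inj m1_ge3 D4)).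
- by move=> e v; apply: odd_fix_scalar.
- by move=> e v; apply: odd_fix_scalar.
- by move=> e u pe; apply: odd_fix_inverse pe u.
by move=> e u pe; apply: odd_fix_inverse pe u.
Qed.

Lemma odd_card_two (K : finFieldType) : odd #|K| -> 2%:R != 0 :> K.
Proof.
move=> oddK; apply/eqP => two.
have : (#|K|%:R : K) = 0.
  have := expg_cardG (in_setT (1 : K)); rewrite cardsT.
  by rewrite FinRing.zmodXgE.
rewrite -(odd_double_half #|K|) oddK -muln2 natrD natrM two mulr0 addr0.
by move/eqP; rewrite oner_eq0.
Qed.

Lemma D4_finite_decomposition (K : finFieldType) : odd #|K| ->
  sum_of_fields_and_quaternion_algebras (group_algebra K gT)
    (\dim (twisted_fix G s (1 : K) [:: #|K|])) (\dim (twisted_fix Z s (-1 : K)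
      [:: #|K|])).
Proof.
move=> oddq; have two := odd_card_two oddq.
have twp := D4_twp two; have twm := D4_twm two.
have coq : coprime n #|K| by apply: coprime_odd_card.
have odd1 : {in [:: #|K|], forall r, odd r} by move=> r; rewrite inE => /eqP->.
have co1 : {in [:: #|K|], forall r, coprime n r} by move=> r;
  rewrite inE => /eqP->.
apply: (decomposition_of_fixed twp twm odd1 co1 (card_group_neq0 twp G2) Zcomm
  (D4_conj_s m1_ge3 D4) (D4_rep_cover m1_ge3 D4) (D4_rep_inj m1_ge3 D4)).
- by move=> e v; apply: twisted_fix_scalar.
- by move=> e v; apply: twisted_fix_scalar.
- by move=> e u; apply: twisted_inverse.
by move=> e u; apply: twisted_inverse.
Qed.

End Counts.

Local Close Scope ring_scope.

Theorem theorem6p1 (m1 m2 : nat) (gT : finGroupType) (t1 t2 x y : gT)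
    (L : splittingFieldType rat) (zeta : L) :
  (3 <= m1)%N -> (3 <= m2)%N ->
  presented_D4 m1 m2 t1 t2 x y ->
  let G : {group gT} := [set: gT]%G in
  let s : gT := (t1 ^+ (2 ^ m1.-1))%g in
  ((exponent G).-primitive_root zeta)%R ->
  let N1 := number_of_cyclic_subgroups 'Z(G)%g in
  let N2 := #|K_classes_involving G zeta s x| in
  let N3 := #|K_classes_involving G zeta s y| in
  let N4 := #|K_classes_involving G zeta s (x * y)%g| in
  let N := (N1 + N2 + N3 + N4)%N in
  let N0 := number_of_cyclic_subgroups (G / G^`(1))%g in
  let M := (2 * N - 10)%N in
  let M0 := (2 * N0 - 10)%N in
  (* no subtraction of natural numbers is truncated *)
  [/\ (N0 <= N)%N, (10 <= 2 * N0)%N,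
      sum_of_fields_and_quaternion_algebras (group_algebra rat gT) N0 (N - N0)
    & forall K : finFieldType, odd #|K| ->
        exists n : nat,
          [/\ number_of_simple_components (group_algebra K gT) n,
              (M <= n)%N
            & #|K| = 3 %[mod 8] ->
                [/\ n = M, (M - M0)%N = (2 * (N - N0))%N
                  & sum_of_fields_and_quaternion_algebras
                      (group_algebra K gT) M0 (M - M0)]]].
Proof.
move=> m1_ge3 m2_ge3 D4 G s zetaP N1 N2 N3 N4 N N0 M M0.
have N0E : N0 = #|(fun a : gT => <[coset G^`(1) a]>%g) @: G|.
  exact: number_of_cyclic_subgroups_coset.
have ten := D4_ten_le m1_ge3 m2_ge3 D4; rewrite -N0E in ten.
have sumE (K : fieldType) : (2%:R != 0 :> K)%R ->
    (\dim (twisted_fix 'Z(G)%G s (-1 : K)%R (odds #|[set: gT]|)) + N0 = N)%N.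
  by move=> two; exact: (dim_odd_minus_classes m1_ge3 D4).
have leN : (N0 <= N)%N by rewrite -(sumE rat)// leq_addl.
have minusE (K : fieldType) : (2%:R != 0 :> K)%R ->
    \dim (twisted_fix 'Z(G)%G s (-1 : K)%R (odds #|[set: gT]|)) = (N - N0)%N.
  by move=> two; rewrite -(sumE K two) addnK.
split=> //; first by move: ten; clear; lia.
  have := D4_rational_decomposition m1_ge3 D4 (isT : (2%:R != 0 :> rat)%R)
    irreducible_Xpow2_add1.
  by rewrite -/s minusE// (dim_odd_plus m1_ge3 D4) ?inE// -N0E.
move=> K oddq; have two := odd_card_two oddq.
have dec := D4_finite_decomposition m1_ge3 D4 oddq.
have [t Zt t4] := D4_root4 m1_ge3 D4.
have G2 := D4_pgroup m1_ge3 D4; have Gn1 := D4_card_gt1 m1_ge3 D4.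
have s1 := D4_s_neq1 m1_ge3 D4; have twm := D4_twm m1_ge3 D4 two.
have geM := dim_minus_ge twm G2 Gn1 oddq Zt t4.
have eqM := dim_minus_eq twm G2 Gn1 oddq s1 Zt t4.
rewrite -/s minusE// in dec geM eqM.
have geP := D4_orbits_ge m1_ge3 m2_ge3 D4 oddq.
have eqP := D4_orbits_eq m1_ge3 m2_ge3 D4 oddq.
rewrite -(dim_power_plus m1_ge3 D4 K oddq) -N0E in geP eqP.
rewrite -/s in geP eqP.
set a := \dim _ in geP eqP dec; set b := \dim _ in geM eqM dec; clearbody a b.
(* There are a >= 2 N0 - 10 fields and b >= 2 (N - N0) quaternion algebras; the sum of the bounds is
   M, and the correction 10 concerns the fields alone. *)
exists (a + b)%N; split; first exact: number_of_simple_components_sum dec.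
  by rewrite /M; clear -leN ten geM geP; lia.
move=> q3; have aE := eqP q3; have bE := eqM q3.
have MM0 : (M - M0 = 2 * (N - N0))%N by rewrite /M /M0; clear -leN ten; lia.
split=> //; first by rewrite aE bE /M; clear -leN ten; lia.
by rewrite MM0 /M0 -aE -bE.
Qed.
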